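(* Consider the random walk in dynamical random environment described in the context, with all the stated assumptions. Then for $\Pi$-almost every realisation $\xi$ of the environment, under the quenched law $\mathbb{P}_\xi$, $$\frac{1}{\sqrt{t}}\,Y_t \Longrightarrow \mathcal{N}(0,\eta^2)\qquad (t\to\infty),$$ i.e. $t^{-1/2}Y_t$ converges in distribution to $(\eta^2)^{1/2}U$, where $U$ is a standard $n$-dimensional Gaussian vector and $\eta^2$ is the positive semidefinite $n\times n$ matrix with entries $$(\eta^2)_{ij}=\sum_{u\in\mathbb{Z}^n}(u_i-b_i)(u_j-b_j)\,\bar P(u),\qquad 1\le i,j\le n.$$
   Context: Let $\mathbb{S}$ be a finite set and $\pi$ a probability measure on $\mathbb{S}$. The environment is a random field $\xi=\{\xi_t(x): x\in\mathbb{Z}^n, t\in\mathbb{Z}^+\}$ of i.i.d. $\mathbb{S}$-valued random variables with law $\pi$; let $\Pi$ denote the corresponding product law on $\mathbb{S}^{\mathbb{Z}^n\times\mathbb{Z}^+}$. Let $P_0$ be a probability distribution on $\mathbb{Z}^n$ and $c:\mathbb{Z}^n\times\mathbb{S}\to\mathbb{R}$ such that: $0\le P_0(u)+c(u,s)\le 1$ for all $u,s$; $\sum_{u}c(u,s)=0$ for all $s$; $\sum_{s}c(u,s)\pi(s)=0$ for all $u$; $P_0$ and $c$ have bounded range (vanish for $|u|$ large); and there is $b^c\in\mathbb{R}^n$ with $\sum_u u\,c(u,s)=b^c$ for all $s\in\mathbb{S}$. Given $\xi$, $(X_t)_{t\in\mathbb{Z}^+}$ is the Markov chain on $\mathbb{Z}^n$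 (started from a fixed deterministic point) with transition probabilities $\mathbb{P}(X_{t+1}=y\mid X_t=x,\xi)=P_0(y-x)+c(y-x,\xi_t(x))$; $\mathbb{P}_\xi$ denotes this conditional (quenched) law. Let $\bar P(u)=P_0(u)+\sum_{s}\pi(s)c(u,s)$, $b^0=\sum_u uP_0(u)$, $b=b^0+b^c$, and $Y_t=X_t-tb$. *)

(* Defs.v *)
From HB Require Import structures.
From mathcomp Require Import all_boot all_order all_algebra.
From mathcomp Require Import all_classical all_reals all_analysis.
Set Implicit Arguments. Unset Strict Implicit. Unset Printing Implicit Defensive.
Import Order.TTheory GRing.Theory Num.Theory.
Import numFieldNormedType.Exports.
Local Open Scope classical_set_scope.
Local Open Scope ring_scope.

Definition zr (R : realType) (n : nat) (u : 'rV[int]_n) : 'rV[R]_n :=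
  map_mx (fun z : int => z%:~R) u.

Definition iid_field (R : realType) (d : measure_display) (Omega : measurableType d)
  (P : probability Omega R) (S : finType) (n : nat) (pi : S -> R)
  (xi : Omega -> 'rV[int]_n -> nat -> S) : Prop :=
  (forall (x : 'rV[int]_n) (t : nat) (s : S),
      measurable [set w | xi w x t = s]) /\
  (forall (sites : seq ('rV[int]_n * nat)) (v : 'rV[int]_n * nat -> S),
      uniq sites ->
      P (\bigcap_(z in [set z | z \in sites]) [set w | xi w z.1 z.2 = v z])
        = (\prod_(z <- sites) pi (v z))%:E).

(* Quenched law of X_t given the environment e (e x t = xi_t(x)), started at x0:
   qlaw t y = P_xi(X_t = y), via the Chapman-Kolmogorov recursion
   P(X_{t+1} = y) = sum_x P(X_t = x) (P0 (y - x) + c (y - x) (xi_t(x))).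
   The sum is a finitely supported sum (fsbigop) over all of Z^n. *)
Fixpoint qlaw (R : realType) (n : nat) (S : Type) (P0 : 'rV[int]_n -> R)
  (c : 'rV[int]_n -> S -> R) (e : 'rV[int]_n -> nat -> S) (x0 : 'rV[int]_n)
  (t : nat) : 'rV[int]_n -> R :=
  match t with
  | 0%N => fun y => (y == x0)%:R
  | t'.+1 => fun y => \sum_(x \in [set: 'rV[int]_n])
        qlaw P0 c e x0 t' x * (P0 (y - x) + c (y - x) (e x t'))
  end.

(* Expectation E[g(U)] for U a standard Gaussian vector in R^n
   (i.i.d. N(0,1) coordinates), as an iterated integral against normal_prob 0 1. *)
Fixpoint gauss_exp (R : realType) (n : nat) : ('rV[R]_n -> R) -> R :=
  match n with
  | 0%N => fun g => g 0
  | m.+1 => fun g => Rintegral (normal_prob (0:R) 1) [set: R]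
        (fun x : R => gauss_exp (fun v : 'rV[R]_m => g (row_mx (const_mx x : 'rV[R]_1) v)))
  end.

(* Convergence in distribution of the laws mu_t (finitely supported on Z^n,
   pushed forward by phi_t : Z^n -> R^n) to the law of U *m A, U standard
   Gaussian: convergence of expectations of all bounded continuous f. *)
Definition conv_law_gauss (R : realType) (n : nat) (mu : nat -> 'rV[int]_n -> R)
  (phi : nat -> 'rV[int]_n -> 'rV[R]_n) (A : 'M[R]_n) : Prop :=
  forall f : 'rV[R]_n -> R, continuous f -> (exists M : R, forall v, `|f v| <= M) ->
    (fun t : nat => \sum_(y \in [set: 'rV[int]_n]) mu t y * f (phi t y))
      @ \oo --> gauss_exp (fun u : 'rV[R]_n => f (u *m A)).

(* Main.v *)
Require Import Defs.
From HB Require Import structures.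
From mathcomp Require Import all_boot all_order all_algebra.
From mathcomp Require Import all_classical all_reals all_analysis.
From mathcomp Require Import measurable_realfun ring lra.
Set Implicit Arguments. Unset Strict Implicit. Unset Printing Implicit Defensive.
Import Order.TTheory GRing.Theory Num.Theory.
Import numFieldNormedType.Exports.
Local Open Scope classical_set_scope.
Local Open Scope ring_scope.

(** Since the mean step does not depend on the environment, the centred walk is a
    quenched martingale. For a frequency th and r = t^(-1/2), a second order
    expansion of one step gives, for D_k = E_xi cos (al + r th.(X_k - k b)),
      D_(k+1) = exp (- r^2 th.eta^2 th / 2) D_k + M_k + O(r^3),
    where M_k is of order r^2 and, being linear in the centred variables
    c(., xi_k(x)) with coefficients depending on xi_0, ..., xi_(k-1) only, is a
    martingale difference under the law of the environment. The accumulated noise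
    at time t thus has fourth moment O(t^-2), and tends to 0 almost surely by
    Borel-Cantelli; so for almost every environment D_t converges to the Gaussian
    value for the countably many th in (1/L) Z^n. Trigonometric polynomials with
    such frequencies approximate a bounded continuous function on boxes without
    increasing its sup norm, and the quenched second moments give tightness. *)

(** * Expectations over finite product measures *)

(** The frequency r = t^(-1/2) is tied to the final time, so the accumulated noise at time t is the
    end value of a different process for each t: almost sure convergence has to come from summable
    probabilities. The noise has no term of order r because every state s gives the same mean step;
    the environment is first felt through the one-step variance.

    Expectations over the environment are finite sums: with bounded steps the quenched law up to
    time t reads finitely many sites, fixed in advance, and [iid_field] gives the weight of each
    configuration on them. The same finite product expectation serves a second time, with Bernoulli
    trials, to build Bernstein polynomials.

    The exceptional null set must not depend on the test function, so only countably many waves may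
    be used. Real cosines with a phase replace complex exponentials, and two phases are enough to
    recover all of them. *)

(** The marginals may vary with the site: the environment has a constant family, the Bernoulli
    trials of the Bernstein polynomials do not. *)
Definition pexp (R : realType) (T S : finType) (m : T -> S -> R)
  (g : {ffun T -> S} -> R) : R :=
  \sum_(v : {ffun T -> S}) (\prod_z m z (v z)) * g v.

Definition ffupd (T S : finType) (v : {ffun T -> S}) (z : T) (s : S) :
  {ffun T -> S} := [ffun z' => if z' == z then s else v z'].

Section product_expectation.
Variables (R : realType) (T S : finType) (m : T -> S -> R).
Hypothesis m_ge0 : forall z s, 0 <= m z s.
Hypothesis m_sum1 : forall z, \sum_s m z s = 1.
Implicit Types g h : {ffun T -> S} -> R.

Lemma ffupdK (v : {ffun T -> S}) z s : ffupd (ffupd v z s) z (v z) = v.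
Proof.
by apply/ffunP => z'; rewrite !ffunE; case: (eqVneq z' z) => [->|].
Qed.

Lemma ffupd_id (v : {ffun T -> S}) z s : ffupd v z s z = s.
Proof. by rewrite ffunE eqxx. Qed.

Lemma pexpD g h : pexp m (fun v => g v + h v) = pexp m g + pexp m h.
Proof.
by rewrite /pexp -big_split; apply: eq_bigr => v _; rewrite mulrDr.
Qed.

Lemma pexpZ a g : pexp m (fun v => a * g v) = a * pexp m g.
Proof.
by rewrite /pexp big_distrr; apply: eq_bigr => v _ /=; rewrite mulrCA.
Qed.

Lemma pexp_sum (I : eqType) (r : seq I) (g : I -> {ffun T -> S} -> R) :
  pexp m (fun v => \sum_(i <- r) g i v) = \sum_(i <- r) pexp m (g i).
Proof.
rewrite /pexp exchange_big; apply: eq_bigr => v _ /=.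
by rewrite big_distrr.
Qed.

Lemma eq_pexp g h : g =1 h -> pexp m g = pexp m h.
Proof. by move=> gh; apply: eq_bigr => v _; rewrite gh. Qed.

Lemma pexp_weight_ge0 (v : {ffun T -> S}) : 0 <= \prod_z m z (v z).
Proof. exact: prodr_ge0. Qed.

Lemma ler_pexp g h : (forall v, g v <= h v) -> pexp m g <= pexp m h.
Proof.
by move=> gh; apply: ler_sum => v _; rewrite ler_wpM2l// pexp_weight_ge0.
Qed.

Lemma pexp1 : pexp m (fun=> 1) = 1.
Proof.
rewrite /pexp; under eq_bigr do rewrite mulr1.
rewrite -(bigA_distr_bigA m) /=.
by apply: big1 => z _; exact: m_sum1.
Qed.

Lemma pexp_cst a : pexp m (fun=> a) = a.
Proof.
by rewrite -[RHS]mulr1 -pexp1 -pexpZ; apply: eq_pexp => v; rewrite mulr1.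
Qed.

Lemma pexp_norm_le g (M : R) : (forall v, `|g v| <= M) -> `|pexp m g| <= M.
Proof.
move=> gM; rewrite -(pexp_cst M).
apply: le_trans (ler_norm_sum _ _ _) _; apply: ler_sum => v _.
by rewrite normrM ger0_norm ?pexp_weight_ge0// ler_wpM2l ?pexp_weight_ge0.
Qed.

(* Resampling the site z: the pairs (v, s) and (v with s at z, v z) have the
   same weight, and exchanging them is an involution. *)
Lemma pexp_resample z g :
  pexp m g = pexp m (fun v => \sum_s m z s * g (ffupd v z s)).
Proof.
pose sw (p : {ffun T -> S} * S) := (ffupd p.1 z p.2, p.1 z).
have swK : involutive sw.
  by move=> [v s]; rewrite /sw /= ffupdK ffupd_id.
pose W (p : {ffun T -> S} * S) := (\prod_z' m z' (p.1 z')) * m z p.2.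
have Wsw p : W (sw p) = W p.
  case: p => v s; rewrite /W /sw /=.
  rewrite (bigD1 z)//= [in RHS](bigD1 z)//= ffupd_id.
  rewrite (eq_bigr (fun z' => m z' (v z'))); first by ring.
  by move=> z' /negPf z'z; rewrite ffunE z'z.
transitivity (\sum_(p : {ffun T -> S} * S) W p * g p.1).
  rewrite -(pair_bigA _ (fun v s => W (v, s) * g v)) /=.
  apply: eq_bigr => v _; rewrite -big_distrl /=; congr *%R.
  by rewrite /W /= -big_distrr /= m_sum1 mulr1.
rewrite (reindex_inj (inv_inj swK)) /=.
under eq_bigr do rewrite Wsw.
rewrite -(pair_bigA _ (fun v s => W (v, s) * g (ffupd v z s))) /=.
apply: eq_bigr => v _; rewrite big_distrr /=; apply: eq_bigr => s _.
by rewrite /W /= mulrA.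
Qed.

(** Resampling [z] leaves [H] unchanged and averages [psi] to 0. The orthogonality of the
    environmental noise and that of the Bernoulli trials both come from here. *)
Lemma pexp_indep0 z (H : {ffun T -> S} -> R) (psi : S -> R) :
  (forall v s, H (ffupd v z s) = H v) -> \sum_s m z s * psi s = 0 ->
  pexp m (fun v => H v * psi (v z)) = 0.
Proof.
move=> Hz psi0; rewrite (pexp_resample z).
rewrite (eq_pexp (h := fun=> 0)) ?pexp_cst// => v.
under eq_bigr do rewrite Hz ffupd_id mulrCA.
by rewrite -big_distrr /= psi0 mulr0.
Qed.

(* Second moments give [E F_k^2 = O(k B^2)] only, which is not summable for
   [B = O(1/k)]; the fourth moment is. *)
Section moments.
Variables (F M : nat -> {ffun T -> S} -> R) (w B : R) (N : nat).
Hypothesis F0 : forall v, F 0 v = 0.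
Hypothesis FS : forall k v, F k.+1 v = w * F k v + M k v.
Hypothesis w01 : 0 <= w <= 1.
Hypothesis MB : forall k v, `|M k v| <= B.
Hypothesis FM1 : forall k, (k < N)%N -> pexp m (fun v => F k v * M k v) = 0.
Hypothesis FM3 : forall k, (k < N)%N -> pexp m (fun v => F k v ^+ 3 * M k v) = 0.

Let M2B k v : M k v ^+ 2 <= B ^+ 2.
Proof.
rewrite -real_normK ?num_real//; apply: lerXn2r => //.
by rewrite nnegrE (le_trans _ (MB k v)).
Qed.

(** The cross term has mean 0 and w <= 1, so each step adds at most B^2. *)
Lemma pexp_ar2 k : (k <= N)%N -> pexp m (fun v => F k v ^+ 2) <= k%:R * B ^+ 2.
Proof.
elim: k => [|k IH] kN.
  by under eq_pexp do rewrite F0 expr0n/=; rewrite pexp_cst mul0r.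
apply: le_trans (_ : pexp m (fun v =>
    (F k v ^+ 2 + B ^+ 2) + (w *+ 2) * (F k v * M k v)) <= _).
  apply: ler_pexp => v; rewrite FS.
  have /andP[w0 w1] := w01.
  have := M2B k v; have : w ^+ 2 * F k v ^+ 2 <= F k v ^+ 2.
    by rewrite ler_piMl ?sqr_ge0// expr_le1.
  by nra.
rewrite !pexpD pexpZ FM1// mulr0 addr0 pexp_cst -natr1 mulrDl mul1r lerD2r.
exact: IH (ltnW kN).
Qed.

(** Each step adds at most 8 B^2 E F_k^2 + 3 B^4 <= (8 k + 3) B^4, and 8 k^2 + 8 k + 3 <= 8 (k +
    1)^2. *)
Lemma pexp_ar4 k : (k <= N)%N ->
  pexp m (fun v => F k v ^+ 4) <= 8 * k%:R ^+ 2 * B ^+ 4.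
Proof.
elim: k => [|k IH] kN.
  by under eq_pexp do rewrite F0 expr0n/=; rewrite pexp_cst expr0n mulr0 mul0r.
apply: le_trans (_ : pexp m (fun v => (F k v ^+ 4 + 3 * B ^+ 4) +
    ((8 * B ^+ 2) * F k v ^+ 2 + (4 * w ^+ 3) * (F k v ^+ 3 * M k v))) <= _).
  apply: ler_pexp => v; rewrite FS.
  have /andP[w0 w1] := w01.
  set f := F k v; set x := M k v.
  have x2 : x ^+ 2 <= B ^+ 2 := M2B k v.
  have w2 : w ^+ 2 <= 1 by rewrite expr_le1.
  have w4 : w ^+ 4 <= 1 by rewrite expr_le1.
  have h4 : w ^+ 4 * f ^+ 4 <= f ^+ 4 by rewrite ler_piMl// exprn_even_ge0.
  have hx4 : x ^+ 4 <= B ^+ 4.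
    rewrite (exprM x 2 2) (exprM B 2 2) lerXn2r ?nnegrE ?sqr_ge0//.
  have wf2 : w ^+ 2 * f ^+ 2 <= f ^+ 2 by rewrite ler_piMl ?sqr_ge0.
  have hf2x2 : f ^+ 2 * x ^+ 2 <= B ^+ 2 * f ^+ 2.
    by rewrite mulrC ler_wpM2r ?sqr_ge0.
  have hw : w ^+ 2 * f ^+ 2 * x ^+ 2 <= B ^+ 2 * f ^+ 2.
    by apply: le_trans hf2x2; rewrite ler_wpM2r ?sqr_ge0.
  (* The term in f x^3 need not have mean 0 and is absorbed by its neighbours; this raises the
     coefficients to 6 + 2 = 8 for f^2 x^2 and 1 + 2 = 3 for x^4. *)
  have hm : 4 * w * f * x ^+ 3 <= 2 * (w ^+ 2 * f ^+ 2 * x ^+ 2) + 2 * x ^+ 4.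
    have : 0 <= 2 * (x * (w * f - x)) ^+ 2 by rewrite mulr_ge0// sqr_ge0.
    by lra.
  have -> : (w * f + x) ^+ 4 = w ^+ 4 * f ^+ 4 + 4 * w ^+ 3 * (f ^+ 3 * x) +
     6 * (w ^+ 2 * f ^+ 2 * x ^+ 2) + 4 * w * f * x ^+ 3 + x ^+ 4 by ring.
  by lra.
rewrite !pexpD !pexpZ FM3// mulr0 addr0 pexp_cst.
have h4 := IH (ltnW kN); have h2 := pexp_ar2 (ltnW kN).
have h3 : 8 * B ^+ 2 * pexp m (fun v => F k v ^+ 2) <= 8 * B ^+ 2 * (k%:R * B ^+ 2).
  by rewrite ler_wpM2l// mulr_ge0// sqr_ge0.
have hB : 0 <= B ^+ 4 by rewrite exprn_even_ge0.
have hk : 0 <= k%:R :> R by [].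
rewrite -natr1; nra.
Qed.

End moments.
End product_expectation.

(** * The quenched walk *)

Lemma fsum_seq (V : nmodType) (T : choiceType) (f : T -> V) (s : seq T) :
  uniq s -> (forall x, x \notin s -> f x = 0) ->
  \sum_(x \in [set: T]) f x = \sum_(x <- s) f x.
Proof.
move=> us f0; rewrite [RHS]fsbig_seq//; apply/esym.
apply: fsbig_widen => // x [_ /= xs]; apply: f0; exact/negP.
Qed.

(** Contains the support of the quenched law at time k for every environment, so that sums and sites
    can be fixed before the environment is. *)
Fixpoint reach (n : nat) (U : seq 'rV[int]_n) (x0 : 'rV[int]_n) (k : nat) :
  seq 'rV[int]_n :=
  if k is k'.+1 then undup [seq x + u | x <- reach U x0 k', u <- U]
  else [:: x0].

Section quenched_expectation.
Variables (R : realType) (n : nat) (S : Type).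
Variables (P0 : 'rV[int]_n -> R) (c : 'rV[int]_n -> S -> R).
Variables (x0 : 'rV[int]_n) (U : seq 'rV[int]_n).
Hypothesis uniqU : uniq U.
Hypothesis stepU : forall u s, u \notin U -> P0 u + c u s = 0.
Implicit Types (e : 'rV[int]_n -> nat -> S) (g h : 'rV[int]_n -> R).

Definition qexp e k g := \sum_(x <- reach U x0 k) qlaw P0 c e x0 k x * g x.

Lemma reach_uniq k : uniq (reach U x0 k).
Proof. by case: k => //= k; rewrite undup_uniq. Qed.

Lemma reachS k x y : x \in reach U x0 k -> y \notin reach U x0 k.+1 ->
  y - x \notin U.
Proof.
move=> xk; apply: contra => yxU /=; rewrite mem_undup; apply/allpairsP.
by exists (x, y - x); split => //=; rewrite addrC subrK.
Qed.

Lemma qlaw_reach e k x : x \notin reach U x0 k -> qlaw P0 c e x0 k x = 0.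
Proof.
elim: k x => [|k IH] x /=; first by rewrite inE => /negPf ->.
move=> xk; rewrite (fsum_seq (reach_uniq k)); last first.
  by move=> y /IH ->; rewrite mul0r.
rewrite big_seq big1// => y yk.
by rewrite stepU ?mulr0//; exact: reachS yk xk.
Qed.

Lemma qlawS e k y : qlaw P0 c e x0 k.+1 y =
  \sum_(x <- reach U x0 k) qlaw P0 c e x0 k x * (P0 (y - x) + c (y - x) (e x k)).
Proof.
rewrite /= (fsum_seq (reach_uniq k))// => x xk.
by rewrite qlaw_reach ?mul0r.
Qed.

Lemma fsum_qlaw e k g :
  \sum_(y \in [set: 'rV[int]_n]) qlaw P0 c e x0 k y * g y = qexp e k g.
Proof.
by rewrite (fsum_seq (reach_uniq k))// => x xk; rewrite qlaw_reach ?mul0r.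
Qed.

Lemma qexp0 e g : qexp e 0 g = g x0.
Proof. by rewrite /qexp big_seq1 /= eqxx mul1r. Qed.

Lemma qexpS e k g : qexp e k.+1 g =
  qexp e k (fun x => \sum_(u <- U) (P0 u + c u (e x k)) * g (x + u)).
Proof.
rewrite /qexp; under eq_bigr do rewrite qlawS mulr_suml.
rewrite exchange_big /= big_seq [RHS]big_seq; apply: eq_bigr => x xk.
under eq_bigr do rewrite -mulrA.
rewrite -mulr_sumr; congr *%R.
(* The lists [reach] at k + 1 and x + U differ; both sums equal the one over the whole lattice,
   because the weight vanishes off either list. *)
transitivity (\sum_(y \in [set: 'rV[int]_n])
    (P0 (y - x) + c (y - x) (e x k)) * g y).
  rewrite (fsum_seq (reach_uniq k.+1))// => y yk.
  by rewrite stepU ?mul0r//; exact: reachS xk yk.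
rewrite (fsum_seq (s := [seq x + u | u <- U])).
- by rewrite big_map; apply: eq_bigr => u _; rewrite [x + u]addrC addrK addrC.
- by rewrite map_inj_uniq//; exact: addrI.
- move=> y yU; rewrite stepU ?mul0r//; apply: contra yU => yxU.
  by apply/mapP; exists (y - x) => //; rewrite addrC subrK.
Qed.

Lemma eq_qexp e k g h : g =1 h -> qexp e k g = qexp e k h.
Proof. by move=> gh; apply: eq_bigr => x _; rewrite gh. Qed.

Lemma qexpD e k g h : qexp e k (fun x => g x + h x) = qexp e k g + qexp e k h.
Proof.
by rewrite /qexp -big_split; apply: eq_bigr => x _; rewrite mulrDr.
Qed.

Lemma qexpZ e k a g : qexp e k (fun x => a * g x) = a * qexp e k g.
Proof. by rewrite /qexp mulr_sumr; apply: eq_bigr => x _; rewrite mulrCA. Qed.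

(** Adaptedness: the law at time k reads the environment at earlier times only, which leaves the
    sites at time k fresh. *)
Lemma qlaw_local e e' k :
  (forall j x, (j < k)%N -> x \in reach U x0 j -> e x j = e' x j) ->
  qlaw P0 c e x0 k =1 qlaw P0 c e' x0 k.
Proof.
elim: k => [//|k IH] ee' y; rewrite !qlawS big_seq [RHS]big_seq.
apply: eq_bigr => x xk; rewrite IH; last first.
  by move=> j z jk; apply: ee'; exact: ltnW.
by rewrite ee'.
Qed.

Hypothesis step_ge0 : forall u s, 0 <= P0 u + c u s.
Hypothesis step_sum1 : forall s, \sum_(u <- U) (P0 u + c u s) = 1.

Lemma qlaw_ge0 e k x : 0 <= qlaw P0 c e x0 k x.
Proof.
elim: k x => [|k IH] x; first by rewrite /=.
by rewrite qlawS sumr_ge0// => y _; rewrite mulr_ge0.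
Qed.

Lemma qexp_cst e k a : qexp e k (fun=> a) = a.
Proof.
elim: k => [|k IH]; first by rewrite qexp0.
rewrite qexpS -[RHS]IH; apply: eq_qexp => x.
by rewrite -mulr_suml step_sum1 mul1r.
Qed.

Lemma ler_qexp e k g h : (forall x, g x <= h x) -> qexp e k g <= qexp e k h.
Proof.
by move=> gh; apply: ler_sum => x _; rewrite ler_wpM2l// qlaw_ge0.
Qed.

Lemma qexp_norm e k g : `|qexp e k g| <= qexp e k (fun x => `|g x|).
Proof.
apply: le_trans (ler_norm_sum _ _ _) _; apply: ler_sum => x _.
by rewrite normrM (ger0_norm (qlaw_ge0 _ _ _)).
Qed.

Lemma qexp_norm_le e k g B : (forall x, `|g x| <= B) -> `|qexp e k g| <= B.
Proof.
move=> gB; rewrite -(qexp_cst e k B).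
by apply: le_trans (qexp_norm _ _ _) _; exact: ler_qexp.
Qed.

End quenched_expectation.

(** * Taylor bounds and the expansion of one step *)

Section trig_bounds.
Variable R : realType.
Implicit Types x : R.

(** By the mean value theorem a bound of degree k on the derivative gives one of degree k + 1 on the
    function. From |cos| <= 1 this yields in turn the bounds on sin x, 1 - cos x, x - sin x and cos
    x - 1 + x^2/2, the factorials being dropped. *)
Lemma normr_le_expr_of_derive (f df : R -> R) k :
  (forall x, is_derive x 1 f (df x)) -> f 0 = 0 ->
  (forall x, `|df x| <= `|x| ^+ k) -> forall x, `|f x| <= `|x| ^+ k.+1.
Proof.
move=> fd f0 dfk x.
have cf a b : {within `[a, b], continuous f}.
  by apply: derivable_within_continuous => y _; exact: @ex_derive.
have [x0|x0|->] := ltgtP x 0; last by rewrite f0 normr0 exprn_ge0.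
- have [z] := MVT x0 (fun y _ => fd y) (cf _ _).
  rewrite in_itv/= => /andP[xz z0]; rewrite f0 !sub0r -[in X in _ -> X](normrN (f x)) => ->.
  rewrite mulrN normrN normrM exprSr ler_pM// (le_trans (dfk z))//.
  by rewrite lerXn2r ?nnegrE// !ltr0_norm// lerN2 ltW.
- have [z] := MVT x0 (fun y _ => fd y) (cf _ _).
  rewrite in_itv/= => /andP[z0 zx]; rewrite f0 !subr0 => ->.
  rewrite normrM exprSr ler_pM// (le_trans (dfk z))//.
  by rewrite lerXn2r ?nnegrE// !gtr0_norm// ltW.
Qed.

Lemma normr_sin_le x : `|sin x| <= `|x|.
Proof.
rewrite -[leRHS]expr1; apply: (normr_le_expr_of_derive (df := cos)) => //.
  exact: sin0.
by move=> y; rewrite expr0 cos_max.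
Qed.

Lemma normr_1Bcos_le x : `|1 - cos x| <= `|x| ^+ 2.
Proof.
apply: (normr_le_expr_of_derive (f := fun y => 1 - cos y) (df := sin)) => //.
- move=> y; apply: is_derive_eq.
  by rewrite opprK add0r mul1r.
- by rewrite cos0 subrr.
- by move=> y; rewrite expr1 normr_sin_le.
Qed.

Lemma normr_sinB_le x : `|sin x - x| <= `|x| ^+ 3.
Proof.
rewrite distrC.
apply: (normr_le_expr_of_derive (f := fun y => y - sin y)
  (df := fun y => 1 - cos y)) => //.
- by rewrite sin0 subrr.
- exact: normr_1Bcos_le.
Qed.

Lemma normr_cosB_le x : `|cos x - 1 + x ^+ 2 / 2| <= `|x| ^+ 4.
Proof.
apply: (normr_le_expr_of_derive (f := fun y => cos y - 1 + y ^+ 2 / 2)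
  (df := fun y => y - sin y)) => //.
- move=> y; apply: is_derive_eq.
  by rewrite /GRing.scale /= !mulr1 !mulr0 add0r subr0 -mulr2n -[y *+ 2]mulr_natl mulKf// addrC.
- by rewrite cos0 subrr expr0n/= mul0r addr0.
- by move=> y; rewrite distrC normr_sinB_le.
Qed.

(** From 1 - x <= exp(-x) <= 1/(1 + x) <= 1 - x + x^2. *)
Lemma expRN_le x : 0 <= x -> `|1 - x - expR (- x)| <= x ^+ 2.
Proof.
move=> x0; have h1 := expR_ge1Dx (- x).
have h2 : expR (- x) <= 1 - x + x ^+ 2.
  rewrite expRN; apply: le_trans (_ : (1 + x)^-1 <= _).
    by rewrite lef_pV2 ?posrE ?expR_gt0 ?expR_ge1Dx// ltr_wpDr.
  rewrite -[leLHS]mul1r ler_pdivrMr ?ltr_wpDr//.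
  have : 0 <= x ^+ 3 by rewrite exprn_ge0.
  by lra.
rewrite ler_norml; apply/andP; split; [lra|].
have : 0 <= x ^+ 2 by rewrite sqr_ge0.
lra.
Qed.

(** One step of mean 0 from phase [be]. The reference variance [s2] may differ from the true one:
    the difference stays as an explicit term of order r^2, which becomes the environmental noise.
    The remainders of cos, sin and exp ([E1], [E2], [E3]), of orders r^4, r^3 and r^4, all fit in
    r^3 since r <= 1. *)
Lemma cos_step (I : Type) (U : seq I) (p dl : I -> R) (r s2 be : R) :
  (forall u, 0 <= p u <= 1) -> \sum_(u <- U) p u = 1 ->
  \sum_(u <- U) p u * dl u = 0 -> 0 <= r <= 1 -> 0 <= s2 ->
  `|\sum_(u <- U) p u * cos (be + r * dl u) -
    (expR (- (r ^+ 2 * s2 / 2)) * cos be -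
     r ^+ 2 / 2 * (\sum_(u <- U) p u * dl u ^+ 2 - s2) * cos be)| <=
  (\sum_(u <- U) (`|dl u| ^+ 4 + `|dl u| ^+ 3) + s2 ^+ 2) * r ^+ 3.
Proof.
move=> p01 p1 pd0 /andP[r0 r1] s20.
pose E1 := \sum_(u <- U) p u * (cos (r * dl u) - 1 + (r * dl u) ^+ 2 / 2).
pose E2 := \sum_(u <- U) p u * (sin (r * dl u) - r * dl u).
pose E3 := 1 - r ^+ 2 * s2 / 2 - expR (- (r ^+ 2 * s2 / 2)).
have r3 : 0 <= r ^+ 3 by rewrite exprn_ge0.
have r43 : r ^+ 4 <= r ^+ 3 by rewrite exprS ler_piMl.
have E1b : `|E1| <= (\sum_(u <- U) `|dl u| ^+ 4) * r ^+ 3.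
  rewrite mulr_suml; apply: le_trans (ler_norm_sum _ _ _) _.
  apply: ler_sum => u _; have /andP[pu0 pu1] := p01 u.
  rewrite normrM (ger0_norm pu0).
  apply: le_trans (_ : `|r * dl u| ^+ 4 <= _).
    by rewrite -[leRHS]mul1r ler_pM// normr_cosB_le.
  rewrite normrM exprMn (ger0_norm r0) mulrC.
  by rewrite ler_wpM2l// exprn_ge0.
have E2b : `|E2| <= (\sum_(u <- U) `|dl u| ^+ 3) * r ^+ 3.
  rewrite mulr_suml; apply: le_trans (ler_norm_sum _ _ _) _.
  apply: ler_sum => u _; have /andP[pu0 pu1] := p01 u.
  rewrite normrM (ger0_norm pu0) -exprMn mulrC -[in leRHS](ger0_norm r0).
  rewrite -normrM [dl u * r]mulrC mulrC.
  by rewrite -[leRHS]mul1r ler_pM// normr_sinB_le.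
have E3b : `|E3| <= s2 ^+ 2 * r ^+ 3.
  have h0 : 0 <= r ^+ 2 * s2 / 2 by rewrite divr_ge0// mulr_ge0// sqr_ge0.
  apply: le_trans (expRN_le h0) _.
  have : s2 ^+ 2 * r ^+ 4 <= s2 ^+ 2 * r ^+ 3 by rewrite ler_wpM2l ?sqr_ge0.
  have : 0 <= s2 ^+ 2 * r ^+ 4 by rewrite mulr_ge0 ?exprn_ge0.
  by lra.
rewrite (_ : _ - _ = cos be * (E1 + E3) - sin be * E2); last first.
  under eq_bigr do rewrite cosD mulrBr (mulrCA _ (cos be)) (mulrCA _ (sin be)).
  rewrite sumrB -!mulr_sumr.
  have -> : \sum_(u <- U) p u * cos (r * dl u) =
      E1 + 1 - r ^+ 2 / 2 * \sum_(u <- U) p u * dl u ^+ 2.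
    rewrite -[X in E1 + X]p1 mulr_sumr -big_split -sumrB /=; apply: eq_bigr => u _.
    by field.
  have -> : \sum_(u <- U) p u * sin (r * dl u) = E2.
    rewrite /E2; under [RHS]eq_bigr do rewrite mulrBr.
    rewrite sumrB; under [X in _ - X]eq_bigr do rewrite mulrCA.
    by rewrite -mulr_sumr pd0 mulr0 subr0.
  by rewrite /E3; field.
apply: le_trans (ler_normB _ _) _; rewrite !normrM.
have hc : `|cos be| * `|E1 + E3| <= `|E1| + `|E3|.
  apply: le_trans (ler_normD E1 E3); rewrite -[leRHS]mul1r ler_wpM2r//.
  exact: cos_max.
have hs : `|sin be| * `|E2| <= `|E2|.
  by rewrite -[leRHS]mul1r ler_wpM2r// sin_max.
rewrite big_split /=; lra.
Qed.

End trig_bounds.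

Definition dotv (R : realType) (n : nat) (a y : 'rV[R]_n) : R :=
  \sum_i a 0 i * y 0 i.

Lemma dotvD (R : realType) (n : nat) (a y z : 'rV[R]_n) :
  dotv a (y + z) = dotv a y + dotv a z.
Proof.
by rewrite /dotv -big_split; apply: eq_bigr => i _; rewrite mxE mulrDr.
Qed.

Lemma dotvZ (R : realType) (n : nat) (a y : 'rV[R]_n) (k : R) :
  dotv a (k *: y) = k * dotv a y.
Proof.
by rewrite /dotv mulr_sumr; apply: eq_bigr => i _; rewrite mxE mulrCA.
Qed.

Lemma dotv0 (R : realType) (n : nat) (a : 'rV[R]_n) : dotv a 0 = 0.
Proof. by rewrite /dotv big1// => i _; rewrite mxE mulr0. Qed.

Lemma dotv_sum (R : realType) (n : nat) (a : 'rV[R]_n) (I : Type) (r : seq I)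
  (y : I -> 'rV[R]_n) :
  dotv a (\sum_(i <- r) y i) = \sum_(i <- r) dotv a (y i).
Proof.
by elim/big_rec2: _ => [|i s z _ <-]; rewrite ?dotv0 ?dotvD.
Qed.

Lemma zrD (R : realType) (n : nat) (x y : 'rV[int]_n) :
  zr R (x + y) = zr R x + zr R y.
Proof. by apply/rowP => i; rewrite !mxE intrD. Qed.

(** * The quenched characteristic function: Gaussian decay plus environmental noise *)

Section characteristic_function.
Variables (R : realType) (n : nat) (S : finType).
Variables (P0 : 'rV[int]_n -> R) (c : 'rV[int]_n -> S -> R).
Variables (x0 : 'rV[int]_n) (U : seq 'rV[int]_n) (b : 'rV[R]_n).
Hypothesis uniqU : uniq U.
Hypothesis stepU : forall u s, u \notin U -> P0 u + c u s = 0.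
Hypothesis step01 : forall u s, 0 <= P0 u + c u s <= 1.
Hypothesis step_sum1 : forall s, \sum_(u <- U) (P0 u + c u s) = 1.
Hypothesis step_mean : forall s,
  \sum_(u <- U) (P0 u + c u s) *: (zr R u - b) = 0.
Implicit Types (e : 'rV[int]_n -> nat -> S) (th : 'rV[R]_n).

Let step_ge0 u s : 0 <= P0 u + c u s.
Proof. by have /andP[] := step01 u s. Qed.

Local Notation E := (qexp P0 c x0 U).

Definition incr th u := dotv th (zr R u - b).

Definition var0 th := \sum_(u <- U) P0 u * incr th u ^+ 2.

(** Excess of the one-step variance in state [s] over [var0]; its mean under [pi] is 0
    ([env_var_mean0]). *)
Definition env_var th s := \sum_(u <- U) c u s * incr th u ^+ 2.

(** Phases 0 and -pi/2 give the real and imaginary parts of the characteristic function. *)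
Definition wave th r al k x := cos (al + r * dotv th (zr R x - k%:R *: b)).

Definition env_noise th r al e k :=
  - (r ^+ 2 / 2) * E e k (fun x => env_var th (e x k) * wave th r al k x).

(* The part of [E e k wave] driven by the environment: its increments are
   martingale differences under the law of the environment. *)
Fixpoint fluct th r al e k : R :=
  if k is k'.+1 then
    expR (- (r ^+ 2 * var0 th / 2)) * fluct th r al e k' +
    env_noise th r al e k'
  else 0.

Lemma step_incr0 th s : \sum_(u <- U) (P0 u + c u s) * incr th u = 0.
Proof.
have := congr1 (dotv th) (step_mean s); rewrite dotv_sum dotv0 => {2}<-.
by apply: eq_bigr => u _; rewrite dotvZ.
Qed.

Lemma waveS th r al k x u :
  wave th r al k.+1 (x + u) =
  cos ((al + r * dotv th (zr R x - k%:R *: b)) + r * incr th u).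
Proof.
rewrite /wave /incr -addrA -mulrDr -dotvD; do 3 congr (_ _).
congr dotv; rewrite zrD -natr1 scalerDl scale1r opprD.
by rewrite -!addrA; congr (_ + _); rewrite addrCA.
Qed.

Lemma wave_le1 th r al k x : `|wave th r al k x| <= 1.
Proof. exact: cos_max. Qed.

Lemma env_noise_le th r al e k :
  `|env_noise th r al e k| <= (\sum_s `|env_var th s|) * r ^+ 2.
Proof.
rewrite /env_noise normrM normrN mulrC.
have r2 : 0 <= r ^+ 2 by rewrite sqr_ge0.
rewrite (ger0_norm (divr_ge0 r2 _))//; apply: ler_pM => //.
- by rewrite divr_ge0.
- apply: qexp_norm_le => // x; rewrite normrM.
  rewrite -[leRHS]mulr1 ler_pM ?wave_le1//.
  by rewrite (bigD1 (e x k))//= lerDl sumr_ge0.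
- by lra.
Qed.

(** Without the one-step errors, w^k D_0 + [fluct] would solve the recursion for D_k exactly; as w
    <= 1, the errors at most add up. For k = t and r = t^(-1/2) the bound is of order t^(-1/2). *)
Lemma qexp_wave_fluct th r al e k : 0 <= r <= 1 -> 0 <= var0 th ->
  `|E e k (wave th r al k) -
    expR (- (r ^+ 2 * var0 th / 2)) ^+ k * wave th r al 0 x0 -
    fluct th r al e k| <=
  k%:R * ((\sum_(u <- U) (`|incr th u| ^+ 4 + `|incr th u| ^+ 3) +
     var0 th ^+ 2) * r ^+ 3).
Proof.
move=> r01 v0; set w := expR _; set C := (X in _ <= _ * X).
have /andP[w0 w1] : 0 <= w <= 1.
  rewrite expR_ge0 /= /w -expR0 ler_expR oppr_le0 divr_ge0// mulr_ge0//.
  exact: sqr_ge0.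
elim: k => [|k IH].
  by rewrite qexp0 expr0 mul1r subrr subr0 normr0 mul0r.
have -> : E e k.+1 (wave th r al k.+1) = w * E e k (wave th r al k) +
    env_noise th r al e k +
    E e k (fun x => \sum_(u <- U) (P0 u + c u (e x k)) *
        cos ((al + r * dotv th (zr R x - k%:R *: b)) + r * incr th u) -
      (w * wave th r al k x -
       r ^+ 2 / 2 * env_var th (e x k) * wave th r al k x)).
  rewrite qexpS// -qexpZ /env_noise -qexpZ -!qexpD; apply: eq_qexp => x.
  under eq_bigr do rewrite waveS.
  by ring.
set Err := E e k (fun x => _ - _).
have ErrC : `|Err| <= C.
  apply: qexp_norm_le => // x.
  have -> : env_var th (e x k) =
     \sum_(u <- U) (P0 u + c u (e x k)) * incr th u ^+ 2 - var0 th.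
    rewrite /env_var /var0 -sumrB; apply: eq_bigr => u _; ring.
  by apply: cos_step => //; exact: step_incr0.
rewrite /= -/w exprS -natr1 mulrDl mul1r.
set a := E e k _ in IH *; set f := fluct _ _ _ _ _ in IH *.
set m := env_noise _ _ _ _ _.
set g := wave _ _ _ _ _ in IH *.
have -> : w * a + m + Err - w * w ^+ k * g - (w * f + m) =
   w * (a - w ^+ k * g - f) + Err by ring.
apply: le_trans (ler_normD _ _) _; apply: lerD => //.
rewrite normrM (ger0_norm w0); apply: le_trans IH.
by rewrite ler_piMl.
Qed.

Lemma fluct_local th r al e e' k :
  (forall j x, (j < k)%N -> x \in reach U x0 j -> e x j = e' x j) ->
  fluct th r al e k = fluct th r al e' k.
Proof.
elim: k => [//|k IH] ee' /=; rewrite IH; last first.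
  by move=> j x jk; apply: ee'; exact: ltnW.
congr (_ + _ * _); rewrite /qexp big_seq [RHS]big_seq.
apply: eq_bigr => x xk; rewrite ee'// (qlaw_local stepU (e' := e'))//.
by move=> j y jk; apply: ee'; exact: ltnW.
Qed.

(** The cross term vanishes because the centred step has mean 0. Bounding step probabilities by 1
    makes the growth per step independent of the environment. *)
Lemma qexp_coord2 e k (i : 'I_n) :
  E e k (fun x => (zr R x - k%:R *: b) 0 i ^+ 2) <=
  zr R x0 0 i ^+ 2 + k%:R * \sum_(u <- U) (zr R u - b) 0 i ^+ 2.
Proof.
elim: k => [|k IH].
  by rewrite qexp0 scale0r subr0 mul0r addr0.
rewrite -natr1 mulrDl mul1r addrA.
apply: le_trans (lerD IH (lexx _)).
rewrite qexpS// -[X in _ <= _ + X](qexp_cst x0 uniqU stepU step_sum1 e k) -qexpD.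
apply: ler_qexp => // x.
set y := (zr R x - k%:R *: b) 0 i.
have -> : \sum_(u <- U) (P0 u + c u (e x k)) * (zr R (x + u) - (k%:R + 1) *: b) 0 i ^+ 2 =
  y ^+ 2 * (\sum_(u <- U) (P0 u + c u (e x k))) +
  (y *+ 2) * (\sum_(u <- U) (P0 u + c u (e x k)) *: (zr R u - b)) 0 i +
  \sum_(u <- U) (P0 u + c u (e x k)) * (zr R u - b) 0 i ^+ 2.
  rewrite summxE !mulr_sumr -!big_split /=; apply: eq_bigr => u _.
  have -> : (zr R (x + u) - (k%:R + 1) *: b) 0 i = y + (zr R u - b) 0 i.
    by rewrite /y zrD !mxE; ring.
  by rewrite [in RHS]mxE; ring.
rewrite step_sum1 step_mean mxE mulr0 addr0 mulr1 lerD2l.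
apply: ler_sum => u _; have /andP[_ h] := step01 u (e x k).
by rewrite ler_piMl// sqr_ge0.
Qed.

End characteristic_function.

(** * Fluctuations over the environment *)

Section environment.
Variables (R : realType) (n : nat) (S : finType) (pi : S -> R).
Variables (P0 : 'rV[int]_n -> R) (c : 'rV[int]_n -> S -> R).
Variables (x0 : 'rV[int]_n) (U : seq 'rV[int]_n) (b : 'rV[R]_n) (s0 : S).
Hypothesis pi_ge0 : forall s, 0 <= pi s.
Hypothesis pi_sum1 : \sum_s pi s = 1.
Hypothesis uniqU : uniq U.
Hypothesis stepU : forall u s, u \notin U -> P0 u + c u s = 0.
Hypothesis step01 : forall u s, 0 <= P0 u + c u s <= 1.
Hypothesis step_sum1 : forall s, \sum_(u <- U) (P0 u + c u s) = 1.
Hypothesis env_mean : forall u, \sum_s c u s * pi s = 0.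

Definition sites (N : nat) : seq ('rV[int]_n * nat) :=
  [seq (x, j) | j <- iota 0 N, x <- reach U x0 j].

Lemma sites_uniq N : uniq (sites N).
Proof.
apply: allpairs_uniq_dep => [|j _|]; first exact: iota_uniq.
  exact: reach_uniq.
by move=> [j x] [k y] /= _ _ [-> ->].
Qed.

Lemma mem_sites N x j :
  ((x, j) \in sites N) = (j < N)%N && (x \in reach U x0 j).
Proof.
apply/allpairsPdep/andP => [[k [y [kN yk [-> ->]]]]|[jN xj]].
  by split=> //; move: kN; rewrite mem_iota.
by exists j, x; rewrite mem_iota.
Qed.

(** Extends a configuration on finitely many sites to a full environment, to which the quenched
    functionals apply; [s0] is a filler off these sites. *)
Definition env_of N (v : {ffun seq_sub (sites N) -> S}) :
    'rV[int]_n -> nat -> S :=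
  fun x j => if insub (x, j) is Some z then v z else s0.

Lemma env_ofE N (v : {ffun seq_sub (sites N) -> S}) x j
  (xj : (x, j) \in sites N) : env_of v x j = v (SeqSub xj).
Proof. by rewrite /env_of insubT. Qed.

Lemma env_of_upd N (v : {ffun seq_sub (sites N) -> S}) z s x j :
  (x, j) != ssval z -> env_of (ffupd v z s) x j = env_of v x j.
Proof.
rewrite /env_of; case: insubP => [z' _ zE|//] xjz.
by rewrite ffunE; case: (eqVneq z' z) => // z'z; rewrite -z'z -zE eqxx in xjz.
Qed.

Variables (th : 'rV[R]_n) (r al : R).
Hypothesis v0 : 0 <= var0 P0 U b th.

Let F N k (v : {ffun seq_sub (sites N) -> S}) :=
  fluct P0 c x0 U b th r al (env_of v) k.
Let M N k (v : {ffun seq_sub (sites N) -> S}) :=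
  env_noise P0 c x0 U b th r al (env_of v) k.

Lemma env_var_mean0 : \sum_s pi s * env_var c U b th s = 0.
Proof.
under eq_bigr do rewrite mulr_sumr.
rewrite exchange_big big1//= => u _.
under eq_bigr do rewrite mulrA [pi _ * _]mulrC.
by rewrite -mulr_suml env_mean mul0r.
Qed.

(** [F k] reads only times before k, and [M k] is a sum over x of [env_var] at the site (x, k) with
    coefficients that also read earlier times only. Each such site is independent of its
    coefficient, and [env_var] has mean 0. *)
Lemma pexp_fluct_noise0 N k j : (k < N)%N ->
  pexp (fun _ => pi) (fun v => F (N := N) k v ^+ j * M k v) = 0.
Proof.
move=> kN; rewrite /M /env_noise /qexp.
pose H x v := F (N := N) k v ^+ j * (- (r ^+ 2 / 2)) *
  (qlaw P0 c (env_of v) x0 k x * wave b th r al k x).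
rewrite (eq_pexp _ (h := fun v =>
    \sum_(x <- reach U x0 k) H x v * env_var c U b th (env_of v x k))).
  rewrite pexp_sum big_seq big1// => x xk.
  have xkN : (x, k) \in sites N by rewrite mem_sites kN.
  rewrite (eq_pexp _ (h := fun v => H x v * env_var c U b th (v (SeqSub xkN)))).
    apply: pexp_indep0 => //; last exact: env_var_mean0.
    move=> v s; rewrite /H /F.
    have loc y i : (i < k)%N -> y \in reach U x0 i ->
        env_of (ffupd v (SeqSub xkN) s) y i = env_of v y i.
      move=> ik _; apply: env_of_upd; apply/eqP => -[_ /= ikE].
      by rewrite ikE ltnn in ik.
    rewrite (fluct_local b stepU th r al (e' := env_of v)) => [|i y]; last exact: loc.
    by rewrite (qlaw_local stepU (e' := env_of v)) => [//|i y]; exact: loc.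
  by move=> v; rewrite env_ofE.
move=> v; rewrite mulrA mulr_sumr; apply: eq_bigr => x _; rewrite /H; ring.
Qed.

Lemma pexp_fluct4 N :
  pexp (fun _ => pi) (fun v : {ffun seq_sub (sites N) -> S} =>
    fluct P0 c x0 U b th r al (env_of v) N ^+ 4) <=
  8 * N%:R ^+ 2 * ((\sum_s `|env_var c U b th s|) * r ^+ 2) ^+ 4.
Proof.
apply: (pexp_ar4 (fun=> pi_ge0) (fun=> pi_sum1) (F := @F N) (M := @M N) (N := N)
  (w := expR (- (r ^+ 2 * var0 P0 U b th / 2)))) => //.
- rewrite expR_ge0 /= -expR0 ler_expR oppr_le0 divr_ge0// mulr_ge0//.
  exact: sqr_ge0.
- by move=> k v; exact: env_noise_le.
- by move=> k kN; rewrite -(pexp_fluct_noise0 1 kN).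
- by move=> k kN; exact: pexp_fluct_noise0.
Qed.

End environment.

Lemma big_seq_sub_val (R : comPzRingType) (T : choiceType) (s : seq T)
  (f : T -> R) : uniq s ->
  \prod_(z : seq_sub s) f (ssval z) = \prod_(z <- s) f z.
Proof.
move=> us; rewrite -(big_map (@ssval _ s) predT f); apply: perm_big.
apply: uniq_perm => //.
  by rewrite map_inj_uniq ?index_enum_uniq//; exact: val_inj.
move=> z; apply/mapP/idP => [[z' _ ->]|zs]; first exact: ssvalP.
by exists (SeqSub zs); rewrite ?mem_index_enum.
Qed.

Lemma measure_bigsetU_seq_le (d : measure_display) (T : measurableType d)
  (R : realType) (mu : {measure set T -> \bar R}) (I : Type) (r : seq I)
  (Q : pred I) (F : I -> set T) : (forall i, measurable (F i)) ->
  (mu (\big[setU/set0]_(i <- r | Q i) F i) <= \sum_(i <- r | Q i) mu (F i))%E.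
Proof.
move=> mF; elim: r => [|i r IH]; first by rewrite !big_nil measure0.
rewrite !big_cons; case: ifP => // _.
apply: (le_trans (measureU2 _ _ _)) => //; first exact: bigsetU_measurable.
exact: leeD.
Qed.

(** The correction -1/N makes the bound inductive: it telescopes against 1/(N + 1)^2 <= 1/N - 1/(N +
    1). The convention 0^-1 = 0 removes the term t = 0. *)
Lemma sum_inv_sqr_le (R : realType) N :
  \sum_(0 <= t < N.+1) ((t%:R : R)^-1) ^+ 2 <= 2 - N%:R^-1.
Proof.
elim: N => [|[|N] IH].
- by rewrite big_nat1 invr0 expr0n subr0.
- by rewrite big_nat_recr//= big_nat1 invr0 expr0n invr1 /=; lra.
rewrite big_nat_recr//=; apply: le_trans (lerD IH (lexx _)) _.
have N0 : 0 < N.+1%:R :> R by [].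
rewrite -[N.+2%:R]natr1; set x : R := N.+1%:R in N0 *.
have -> : 2 - x^-1 + (x + 1)^-1 ^+ 2 =
    2 - (x + 1)^-1 - (x * (x + 1) ^+ 2)^-1.
  by field; rewrite !gt_eqF// ltr_wpDr.
by rewrite lerBlDr lerDl invr_ge0 mulr_ge0 ?sqr_ge0// ltW.
Qed.

Lemma invsqrt01 (R : realType) (t : nat) :
  0 <= (Num.sqrt (t%:R : R))^-1 <= 1.
Proof.
rewrite invr_ge0 sqrtr_ge0 /=; case: t => [|t].
  by rewrite sqrtr0 invr0.
rewrite invf_le1 ?sqrtr_gt0//.
by rewrite -[leLHS]sqrtr1 ler_wsqrtr// ler1n.
Qed.

Lemma invsqrt_sqr (R : realType) (t : nat) :
  (Num.sqrt (t%:R : R))^-1 ^+ 2 = t%:R^-1.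
Proof. by rewrite exprVn sqr_sqrtr. Qed.

(** * Almost sure vanishing of the accumulated noise *)

Section borel_cantelli_environment.
Variables (R : realType) (n : nat) (S : finType) (pi : S -> R).
Variables (P0 : 'rV[int]_n -> R) (c : 'rV[int]_n -> S -> R).
Variables (x0 : 'rV[int]_n) (U : seq 'rV[int]_n) (b : 'rV[R]_n).
Hypothesis pi_ge0 : forall s, 0 <= pi s.
Hypothesis pi_sum1 : \sum_s pi s = 1.
Hypothesis uniqU : uniq U.
Hypothesis stepU : forall u s, u \notin U -> P0 u + c u s = 0.
Hypothesis step01 : forall u s, 0 <= P0 u + c u s <= 1.
Hypothesis step_sum1 : forall s, \sum_(u <- U) (P0 u + c u s) = 1.
Hypothesis env_mean : forall u, \sum_s c u s * pi s = 0.
Variables (d : measure_display) (Omega : measurableType d).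
Variables (P : probability Omega R) (xi : Omega -> 'rV[int]_n -> nat -> S).
Hypothesis iid_xi : iid_field P pi xi.

(** A function of finitely many sites is constant on each cylinder over them, so the event is a
    finite union of cylinders: it is measurable, and its probability is at most the sum of their
    weights, each multiplied by G / eps >= 1. *)
Lemma cylinder_markov (s0 : S) N (G : ('rV[int]_n -> nat -> S) -> R) (eps : R) :
  (forall e e', (forall x j, (x, j) \in sites x0 U N -> e x j = e' x j) ->
    G e = G e') ->
  (forall e, 0 <= G e) -> 0 < eps ->
  measurable [set w | eps <= G (xi w)] /\
  (P [set w | (eps <= G (xi w))%R] <=
    (pexp (fun=> pi) (fun v => G (env_of s0 (x0 := x0) (U := U) (N := N) v)) / eps)%:E)%E.
Proof.
move=> Gloc G0 eps0; have [mxi pxi] := iid_xi.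
pose env v := env_of s0 (x0 := x0) (U := U) (N := N) v.
pose cyl v := \bigcap_(z in [set z | z \in sites x0 U N])
  [set w | xi w z.1 z.2 = env v z.1 z.2].
have mcyl v : measurable (cyl v).
  by apply: fin_bigcap_measurable => // z _; exact: mxi.
have -> : [set w | eps <= G (xi w)] =
    \big[setU/set0]_(v : {ffun seq_sub (sites x0 U N) -> S} | eps <= G (env v)) cyl v.
  apply/seteqP; split => w /=.
    move=> ew; pose v := [ffun z : seq_sub (sites x0 U N) => xi w (ssval z).1 (ssval z).2].
    have vw x j : (x, j) \in sites x0 U N -> env v x j = xi w x j.
      by move=> xj; rewrite /env env_ofE ffunE.
    rewrite -bigcup_seq_cond; exists v => /=.
      by rewrite mem_index_enum /= (Gloc _ (xi w)).
    by move=> [x j] /= xj; rewrite vw.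
  rewrite -bigcup_seq_cond => -[v /= /andP[_ ev] vw].
  by rewrite (Gloc _ (env v)) // => x j xj; exact: (vw (x, j)).
split; first exact: bigsetU_measurable.
apply: (le_trans (measure_bigsetU_seq_le _ _ _ mcyl)).
rewrite (eq_bigr (fun v : {ffun seq_sub (sites x0 U N) -> S} =>
    (\prod_z pi (v z))%:E)); last first.
  move=> v _.
  transitivity ((\prod_(z <- sites x0 U N) pi (env v z.1 z.2))%:E).
    exact: (pxi _ (fun z => env v z.1 z.2) (sites_uniq _ _ _)).
  rewrite -(big_seq_sub_val _ (sites_uniq x0 U N)); congr EFin.
  by apply: eq_bigr => -[[x j] xj] _ /=; rewrite /env env_ofE.
rewrite sumEFin lee_fin ler_pdivlMr// /pexp mulr_suml.
rewrite big_mkcond /=; apply: ler_sum => v _; case: ifP => h.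
  by rewrite ler_wpM2l// prodr_ge0.
by rewrite mulr_ge0// prodr_ge0.
Qed.

Variables (th : 'rV[R]_n) (al : R).
Hypothesis var_ge0 : 0 <= var0 P0 U b th.

Local Notation rt t := (Num.sqrt (t%:R : R))^-1.

Lemma ae_fluct_cvg0 :
  {ae P, forall w, (fun t => fluct P0 c x0 U b th (rt t) al (xi w) t) @ \oo --> 0}.
Proof.
(* The weights [pi] sum to 1, so S has an element, which serves as filler in [env_of]. *)
have [s0 _] : exists s : S, True.
  apply: contrapT => noS; move: pi_sum1; rewrite big1 => [/eqP|s _].
    by rewrite eq_sym oner_eq0.
  by exfalso; apply: noS; exists s.
pose G t e := fluct P0 c x0 U b th (rt t) al e t.
pose C := \sum_s `|env_var c U b th s|.
have Gloc t e e' : (forall x j, (x, j) \in sites x0 U t -> e x j = e' x j) ->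
    G t e ^+ 4 = G t e' ^+ 4.
  move=> ee'; congr (_ ^+ 4); apply: fluct_local => // j x jt xj.
  by apply: ee'; rewrite mem_sites jt.
have G4 t e : 0 <= G t e ^+ 4 by rewrite exprn_even_ge0.
have bd m t : measurable [set w | (m.+1%:R^-1 ^+ 4 <= G t (xi w) ^+ 4)] /\
    (P [set w | (m.+1%:R^-1 ^+ 4 <= G t (xi w) ^+ 4)%R] <=
     (8 * C ^+ 4 / m.+1%:R^-1 ^+ 4 * (t%:R^-1 ^+ 2))%:E)%E.
  have m0 : 0 < m.+1%:R^-1 ^+ 4 :> R by rewrite exprn_gt0// invr_gt0.
  have [mA PA] := cylinder_markov s0 (Gloc t) (G4 t) m0; split=> //.
  apply: (le_trans PA); rewrite lee_fin mulrAC ler_wpM2r ?invr_ge0 ?(ltW m0)//.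
  apply: le_trans; first exact: pexp_fluct4.
  rewrite invsqrt_sqr -/C; case: t {mA PA} => [|t].
    by rewrite invr0 !expr0n !mulr0 mul0r.
  rewrite le_eqVlt; apply/orP; left; apply/eqP; field.
  by rewrite nat1r pnatr_eq0.
have null m : P (lim_sup_set (fun t =>
    [set w | (m.+1%:R^-1 ^+ 4 <= G t (xi w) ^+ 4)])) = 0%E.
  apply: lim_sup_set_cvg0; first by move=> t; have [] := bd m t.
  set K := (8 * C ^+ 4 / m.+1%:R^-1 ^+ 4).
  have K0 : 0 <= K.
    apply: divr_ge0; first by apply: mulr_ge0 => //; exact: exprn_even_ge0.
    exact: exprn_even_ge0.
  apply: (@le_lt_trans _ _ (K * 2)%:E); last by rewrite ltry.
  apply: lime_le; first exact: is_cvg_nneseries.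
  apply: nearW => N.
  apply: le_trans (_ : (\sum_(0 <= t < N) (K * (t%:R^-1 ^+ 2))%:E <= _)%E).
    by apply: lee_sum => t _; have [] := bd m t.
  rewrite sumEFin lee_fin -mulr_sumr ler_wpM2l//.
  case: N => [|N]; first by rewrite big_geq.
  apply: le_trans (sum_inv_sqr_le _ _) _.
  by rewrite gerBl invr_ge0.
(* Outside the limsup event the sequence stays below the level 1/(m + 1) from some time on;
   intersecting over m gives convergence to 0. *)
have aem m : {ae P, forall w, \forall t \near \oo, `|G t (xi w)| < m.+1%:R^-1}.
  exists (lim_sup_set (fun t => [set w | (m.+1%:R^-1 ^+ 4 <= G t (xi w) ^+ 4)])).
  split=> //.
    apply: bigcapT_measurable => k; apply: bigcup_measurable => t _.
    by have [] := bd m t.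
  move=> w /= nw k _; apply: contrapT => h; apply: nw; exists k => // t /= kt.
  rewrite ltNge; apply/negP => Gt; apply: h; exists t => //=.
  rewrite -[leRHS]ger0_norm// normrX lerXn2r ?nnegrE ?invr_ge0//.
have := ae_foralln aem; apply: filterS => w hw.
apply/cvgr0Pnorm_lt => eps eps0.
have [m _ hm] : \forall m \near \oo, harmonic m < eps.
  by apply: (cvgr_lt _ cvg_harmonic).
near=> t; apply: lt_trans (hm m (leqnn m)).
by near: t; exact: hw.
Unshelve. all: by end_near. Qed.

End borel_cantelli_environment.

(** * Gaussian expectations *)

Lemma Rintegral_dominated_cvg (d : measure_display) (T : measurableType d)
  (R : realType) (mu : {measure set T -> \bar R}) (f_ : nat -> T -> R)
  (f g : T -> R) :
  (forall k, measurable_fun setT (f_ k)) ->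
  (forall x, f_ k x @[k --> \oo] --> f x) ->
  mu.-integrable setT (EFin \o g) -> (forall k x, `|f_ k x| <= g x) ->
  Rintegral mu setT (f_ k) @[k --> \oo] --> Rintegral mu setT f.
Proof.
move=> mf_ cvf intg fg.
have mf : measurable_fun setT f.
  apply/measurable_EFinP.
  apply: (@emeasurable_fun_cvg _ _ _ _ (fun k x => (f_ k x)%:E)) => [k|x _].
    exact/measurable_EFinP.
  by apply: cvg_EFin (cvf x); exact: nearW.
have [||||intf _ h] := @dominated_convergence _ _ _ mu setT measurableT
  (fun k x => (f_ k x)%:E) (EFin \o f) (EFin \o g) _ _ _ intg.
- by move=> k; exact/measurable_EFinP.
- exact/measurable_EFinP.
- by apply: aeW => x _; apply: cvg_EFin (cvf x); exact: nearW.
- by apply: aeW => x k _; rewrite lee_fin.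
by apply: fine_cvg; rewrite /Rintegral fineK ?integrable_fin_num.
Qed.

(** On [-k, k] the fundamental theorem leaves only boundary values of [G]; dominated convergence
    passes to the whole line. *)
Lemma Rintegral_derive_eq0 (R : realType) (G g : R -> R) :
  (forall x : R, is_derive x 1 G (g x)) -> continuous g ->
  lebesgue_measure.-integrable setT (EFin \o g) ->
  G n%:R @[n --> \oo] --> 0 -> G (- n%:R) @[n --> \oo] --> 0 ->
  Rintegral lebesgue_measure setT g = 0.
Proof.
move=> dG cg intg Gy GNy.
pose f_ (k : nat) := g \_ `[- k%:R, k%:R].
have mg : measurable_fun setT g by exact: continuous_measurable_fun.
have h : Rintegral lebesgue_measure setT (f_ k) @[k --> \oo] -->
    Rintegral lebesgue_measure setT g.
  apply: (@Rintegral_dominated_cvg _ _ R lebesgue_measure f_ g (fun x => `|g x|)).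
  - move=> k; apply/(measurable_restrictT _ _).1 => //.
    exact: measurable_funTS.
  - move=> x; apply/cvgrPdist_lt => e e0.
    near=> k; rewrite /f_ patchE mem_set ?subrr ?normr0//=.
    rewrite in_itv/= -ler_norml; near: k.
    exact: nbhs_infty_ger.
  - exact: (integrable_abse intg).
  - move=> k x; rewrite /f_ patchE; case: ifP => // _.
    by rewrite normr0.
(* Shifted to k + 1 so that the interval of integration is never degenerate. *)
have -> : 0 = lim ((fun k : nat => G k.+1%:R - G (- k.+1%:R)) @ \oo).
  apply/esym/cvg_lim => //; rewrite -[0](subrr 0); apply: cvgB.
    by move: Gy; rewrite -cvg_shiftS.
  by move: GNy; rewrite -(cvg_shiftS (fun k => G (- k%:R))).
apply/esym/cvg_lim => //; move: h; rewrite -cvg_shiftS; apply: cvg_trans.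
apply: near_eq_cvg; apply: nearW => k.
rewrite /= /f_ -Rintegral_mkcond /Rintegral.
have k0 : - k.+1%:R < k.+1%:R :> R by rewrite gtrN.
rewrite (continuous_FTC2 (F := G) k0)//.
- exact: continuous_subspaceT.
- have cG x : G y @[y --> x] --> G x.
    by apply: differentiable_continuous; apply/derivable1_diffP.
  split=> //.
  + by apply: cvg_at_right_filter; exact: cG.
  + by apply: cvg_at_left_filter; exact: cG.
- by move=> x _; rewrite derive1E; have [] := dG x.
Unshelve. all: by end_near. Qed.

(** * The characteristic function of the one-dimensional Gaussian *)

Section normal_characteristic_function.
Variable R : realType.
Local Notation mu := (@lebesgue_measure R).
Local Notation N01 := (normal_prob (0:R) 1).
Local Notation p := (normal_pdf (0:R) 1).

Lemma integrable_normal_bounded (f : R -> R) (M : R) : measurable_fun setT f ->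
  (forall x, `|f x| <= M) -> N01.-integrable setT (EFin \o f).
Proof.
move=> mf fM.
apply: (@le_integrable _ _ R N01 setT measurableT _ (EFin \o cst M)).
- exact/measurable_EFinP.
- by move=> x _ /=; rewrite lee_fin (le_trans (fM x))// ler_norm.
- exact: finite_measure_integrable_cst.
Qed.

(** The Radon-Nikodym derivative of the normal law and its density have the same integral over every
    measurable set, hence agree almost everywhere. *)
Lemma Rintegral_normal_prob (f : R -> R) : N01.-integrable setT (EFin \o f) ->
  Rintegral N01 setT f = Rintegral mu setT (fun x => f x * p x).
Proof.
move=> intf; rewrite /Rintegral; congr fine.
have mf := measurable_int _ intf.
rewrite -(Radon_Nikodym_change_of_variables (normal_prob_dominates 0 1))//=.
apply: ae_eq_integral => //.
- apply: emeasurable_funM => //; apply: (measurable_int mu).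
  by apply: Radon_Nikodym_integrable; exact: normal_prob_dominates.
- apply/measurable_EFinP/measurable_funM; first exact/measurable_EFinP.
  exact: measurable_normal_pdf.
- have -> : (fun x => (f x * p x)%:E) = (fun x => (f x)%:E * (p x)%:E)%E.
    by apply/funext => x; rewrite EFinM.
  apply: ae_eqe_mul2l => /=.
  rewrite Radon_NikodymE//=; first exact: normal_prob_dominates.
  move=> numu; case: cid => /= h [h1 h2 h3].
  apply: integral_ae_eq => //=.
    by apply/measurable_EFinP; exact: measurable_normal_pdf.
  by move=> E _ mE; rewrite -h3.
Qed.

Lemma normal_pdf01 x : p x = normal_peak 1 * expR (- (x ^+ 2 / 2)).
Proof.
by rewrite normal_pdfE ?oner_eq0// /normal_fun subr0 expr1n mulNr.
Qed.

Lemma is_derive_normal_pdf (x : R) : is_derive x 1 p (- x * p x).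
Proof.
have -> : p = fun x => normal_peak 1 * expR (- (x ^+ 2 / 2)).
  by apply/funext => y; rewrite normal_pdf01.
apply: is_derive_eq.
by rewrite /GRing.scale /=; field.
Qed.

Lemma normal_pdf_cvg0 : p n%:R @[n --> \oo] --> 0.
Proof.
apply: (@squeeze_cvgr _ _ _ _ (cst 0) (fun n => (normal_peak 1 * 2) * harmonic n)).
(* Here exp(-n^2/2) <= 2/(n + 1), because n + 1 <= 2 + n^2 <= 2 exp(n^2/2). *)
- apply: nearW => n; rewrite normal_pdf_ge0 /= normal_pdf01 -mulrA.
  apply: ler_wpM2l; first exact: normal_peak_ge0.
  rewrite /harmonic /= expRN ler_pdivlMr// mulrC ler_pdivrMr ?expR_gt0//.
  have := expR_ge1Dx (n%:R ^+ 2 / 2 : R).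
  rewrite -[n.+1%:R]natr1; have : 0 <= (n%:R - 1) ^+ 2 :> R by rewrite sqr_ge0.
  have : 0 <= n%:R ^+ 2 :> R by rewrite sqr_ge0.
  by lra.
- exact: cvg_cst.
- by rewrite -[X in _ --> X](mulr0 (normal_peak 1 * 2)); apply: cvgMl_tmp; exact: cvg_harmonic.
Qed.

(** Dominated by a multiple of the density of variance 2: |x| <= 1 + x^2/4 <= exp(x^2/4), which
    leaves exp(-x^2/4). *)
Lemma integrable_normrM_normal_pdf :
  mu.-integrable setT (EFin \o (fun x => `|x| * p x)).
Proof.
pose q := normal_pdf (0:R) (Num.sqrt 2).
have s2 : Num.sqrt 2 != 0 :> R by rewrite gt_eqF// sqrtr_gt0.
apply: (@le_integrable _ _ R mu setT measurableT _ (EFin \o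
    (fun x => (normal_peak 1 / normal_peak (Num.sqrt 2)) * q x))) => //.
- apply/measurable_EFinP/measurable_funM.
    by apply: continuous_measurable_fun; exact: norm_continuous.
  exact: measurable_normal_pdf.
- move=> x _ /=; rewrite lee_fin normal_pdf01 /q normal_pdfE// /normal_fun subr0.
  rewrite mulrA divfK ?gt_eqF ?normal_peak_gt0// mulrCA !normrM ler_wpM2l//.
  rewrite normr_id !(ger0_norm (expR_ge0 _)) sqr_sqrtr//.
  have -> : - (x ^+ 2 / 2) = - (x ^+ 2 / 4) - x ^+ 2 / 4 by field.
  have -> : - x ^+ 2 / (2 *+ 2) = - (x ^+ 2 / 4) :> R by field.
  rewrite expRD mulrCA ler_piMr ?expR_ge0//.
  rewrite expRN ler_pdivrMr ?expR_gt0// mul1r.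
  apply: le_trans (expR_ge1Dx _).
  have : 0 <= (`|x| / 2 - 1) ^+ 2 by rewrite sqr_ge0.
  rewrite -(real_normK (num_real x)); lra.
- exact: (integrableZl measurableT _ (integrable_normal_pdf _ _)).
Qed.


Lemma continuous_cos_affine (al th : R) : continuous (fun x => cos (al + th * x)).
Proof.
move=> x; apply: continuous_comp; last exact: continuous_cos.
apply: cvgD; first exact: cvg_cst.
by apply: cvgMl_tmp; exact: cvg_id.
Qed.

Lemma continuous_sin_affine (al th : R) : continuous (fun x => sin (al + th * x)).
Proof.
move=> x; apply: continuous_comp; last exact: continuous_sin.
apply: cvgD; first exact: cvg_cst.
by apply: cvgMl_tmp; exact: cvg_id.
Qed.

Lemma integrable_cos_pdf al th :
  mu.-integrable setT (EFin \o (fun x => cos (al + th * x) * p x)).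
Proof.
apply: (@le_integrable _ _ R mu setT measurableT _ (EFin \o p)).
- apply/measurable_EFinP/measurable_funM; last exact: measurable_normal_pdf.
  by apply: continuous_measurable_fun; exact: continuous_cos_affine.
- by move=> x _ /=; rewrite lee_fin normrM ler_piMl// cos_max.
- exact: integrable_normal_pdf.
Qed.

Lemma integrable_x_sin_pdf al th :
  mu.-integrable setT (EFin \o (fun x => x * sin (al + th * x) * p x)).
Proof.
apply: (@le_integrable _ _ R mu setT measurableT _ (EFin \o (fun x => `|x| * p x))).
- apply/measurable_EFinP/measurable_funM; last exact: measurable_normal_pdf.
  apply: continuous_measurable_fun => x; apply: cvgM; first exact: cvg_id.
  exact: continuous_sin_affine.
- move=> x _ /=; rewrite lee_fin !normrM normr_id.
  by rewrite ler_wpM2r// ler_piMr// sin_max.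
- exact: integrable_normrM_normal_pdf.
Qed.

Local Notation F al th := (Rintegral mu setT (fun x => cos (al + th * x) * p x)).

(** Since p' = - x p, the difference of the integrands is the derivative of sin(al + th x) p(x),
    which vanishes at both ends. *)
Lemma cos_pdf_by_parts al th :
  Rintegral mu setT (fun x => x * sin (al + th * x) * p x) = th * F al th.
Proof.
have sp0 (u : nat -> R) : p (u n) @[n --> \oo] --> 0 ->
    sin (al + th * u n) * p (u n) @[n --> \oo] --> 0.
  move=> pu; apply: (@squeeze_cvgr _ _ _ _ (fun n => - p (u n)) (fun n => p (u n))) => //.
    apply: nearW => n; rewrite -ler_norml normrM [X in _ * X <= _]ger0_norm ?normal_pdf_ge0//.
    by rewrite ler_piMl ?normal_pdf_ge0// sin_max.
  by have := cvgN pu; rewrite oppr0; apply.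
have h : Rintegral mu setT
    (fun x => th * (cos (al + th * x) * p x) - x * sin (al + th * x) * p x) = 0.
  apply: (@Rintegral_derive_eq0 R (fun x => sin (al + th * x) * p x)).
  - move=> x; have hp := is_derive_normal_pdf x; apply: is_derive_eq.
    by rewrite /GRing.scale /=; ring.
  - move=> x; apply: cvgB; last first.
      apply: cvgM; last exact: continuous_normal_pdf.
      by apply: cvgM; [exact: cvg_id|exact: continuous_sin_affine].
    apply: cvgMl_tmp; apply: cvgM; last exact: continuous_normal_pdf.
    exact: continuous_cos_affine.
  - exact: (integrableB measurableT
      (integrableZl measurableT th (integrable_cos_pdf al th))
      (integrable_x_sin_pdf al th)).
  - by apply: sp0; exact: normal_pdf_cvg0.
  - apply: sp0; have := normal_pdf_cvg0; apply: cvg_trans; apply: near_eq_cvg.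
    by apply: nearW => n; rewrite !normal_pdf01 sqrrN.
rewrite RintegralB// in h.
- rewrite RintegralZl// in h; last exact: integrable_cos_pdf.
  by move/eqP: h; rewrite subr_eq0 => /eqP.
- exact: (integrableZl measurableT th (integrable_cos_pdf al th)).
- exact: integrable_x_sin_pdf.
Qed.

(** Differentiating under the integral sign, with |x| p(x) as dominating function, gives minus the
    integral of [cos_pdf_by_parts]: hence the equation F' = - th F. *)
Lemma is_derive_cos_pdf (al th : R) :
  is_derive th 1 (fun t => F al t) (- th * F al th).
Proof.
pose f (t x : R) := cos (al + t * x) * p x.
have df (t x : R) : is_derive t 1 (f ^~ x) (- (x * sin (al + t * x) * p x)).
  by apply: is_derive_eq; rewrite /GRing.scale /=; ring.
have d1 t x : partial1of2 f t x = - (x * sin (al + t * x) * p x).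
  by rewrite partial1of2E; have [] := df t x.
have Ith : `]th - 1, th + 1[%classic th by rewrite /= in_itv /=; lra.
have intf t : mu.-integrable setT (EFin \o f t) by exact: integrable_cos_pdf.
have Gub (t : R) x : `|partial1of2 f t x| <= `|x| * p x.
  rewrite d1 normrN !normrM (ger0_norm (normal_pdf_ge0 _ _ _)).
  by rewrite ler_wpM2r ?normal_pdf_ge0// ler_piMr// sin_max.
have G0 (x : R) : 0 <= `|x| * p x by rewrite mulr_ge0// normal_pdf_ge0.
apply: DeriveDef.
  apply: (derivable_under_integral measurableT Ith (fun t _ => intf t) _ G0
    integrable_normrM_normal_pdf (fun t x _ _ => Gub t x)).
  by move=> t x _ _; have [] := df t x.
rewrite -derive1E.
rewrite (differentiation_under_integral measurableT Ith (fun t _ => intf t) _ G0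
    integrable_normrM_normal_pdf (fun t x _ _ => Gub t x)); last first.
  by move=> t x _ _; have [] := df t x.
transitivity (Rintegral mu setT
    (fun x => (-1) * (x * sin (al + th * x) * p x))).
  by apply: eq_Rintegral => x _; rewrite d1 mulN1r.
rewrite RintegralZl//; last exact: integrable_x_sin_pdf.
by rewrite cos_pdf_by_parts mulN1r mulNr.
Qed.

(** F(th) exp(th^2/2) has derivative 0 and equals cos al at th = 0. *)
Lemma cos_pdfE al th : F al th = cos al * expR (- (th ^+ 2 / 2)).
Proof.
pose H t := F al t * expR (t ^+ 2 / 2).
have dH (t : R) : is_derive t 1 H 0.
  have dF := is_derive_cos_pdf al t.
  by apply: is_derive_eq; rewrite /GRing.scale /=; field.
have := is_derive_0_is_cst th 0 dH.
rewrite /H expr0n mul0r expR0 mulr1 => h.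
have F0 : F al 0 = cos al.
  rewrite (eq_Rintegral mu (g := fun x => cos al * p x)); last first.
    by move=> x _; rewrite mul0r addr0.
  rewrite RintegralZl//; last exact: integrable_normal_pdf.
  by rewrite /Rintegral integral_normal_pdf mulr1.
by rewrite -F0 -h -mulrA -expRD addrN expR0 mulr1.
Qed.

Lemma normal_prob_cos al th :
  Rintegral N01 setT (fun x => cos (al + th * x)) = cos al * expR (- (th ^+ 2 / 2)).
Proof.
rewrite Rintegral_normal_prob ?cos_pdfE//.
apply: (@integrable_normal_bounded _ 1); last by move=> x; exact: cos_max.
by apply: continuous_measurable_fun; exact: continuous_cos_affine.
Qed.

End normal_characteristic_function.

Lemma cvg_rV (R : realType) (T : Type) (F : set_system T) (n : nat)
  (f : T -> 'rV[R]_n) (l : 'rV[R]_n) : Filter F ->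
  (forall i, f t 0 i @[t --> F] --> l 0 i) -> f @ F --> l.
Proof.
move=> FF fl; apply/cvg_ballP => e e0.
have : \forall t \near F, forall i : 'I_n, ball (l 0 i) e (f t 0 i).
  by apply: filter_forall => i; move/cvg_ballP: (fl i); exact.
by apply: filterS => t h; split=> // i j; rewrite [i]ord1; exact: h.
Qed.

Lemma coord_continuous_rV (R : realType) (n : nat) (i : 'I_n) :
  continuous (fun v : 'rV[R]_n => v 0 i).
Proof. by move=> v; exact: coord_continuous. Qed.

(** * Iterated Gaussian integrals of bounded continuous functions *)

Section gaussian_expectation.
Variable R : realType.
Local Notation N01 := (normal_prob (0:R) 1).

Definition slice m (g : 'rV[R]_m.+1 -> R) (x : R) : 'rV[R]_m -> R :=
  fun v => g (row_mx (const_mx x : 'rV[R]_1) v).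

Lemma gauss_expS m (g : 'rV[R]_m.+1 -> R) :
  gauss_exp g = Rintegral N01 setT (fun x => gauss_exp (slice g x)).
Proof. by []. Qed.

Lemma row_mx_const_cvg (T : Type) (F : set_system T) m (f : T -> R) (l : R)
    (h : T -> 'rV[R]_m) (k : 'rV[R]_m) : Filter F -> f @ F --> l -> h @ F --> k ->
  row_mx (const_mx (f t) : 'rV[R]_1) (h t) @[t --> F] -->
  (row_mx (const_mx l : 'rV[R]_1) k : 'rV[R]_m.+1).
Proof.
move=> FF fl hk; apply: cvg_rV => i.
rewrite mxE; under eq_fun do rewrite mxE.
case: (fintype.split i) => j; rewrite ?mxE.
  by under eq_fun do rewrite mxE.
exact: (cvg_comp h (fun v : 'rV[R]_m => v 0 j) hk (@coord_continuous_rV _ _ _ _)).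
Qed.

Lemma slice_continuous m (g : 'rV[R]_m.+1 -> R) x :
  continuous g -> continuous (slice g x).
Proof.
move=> cg v.
apply: (cvg_comp (fun v => row_mx (const_mx x : 'rV[R]_1) v) g) (cg _).
apply: (@row_mx_const_cvg _ (nbhs v) m (fun=> x) x id v).
  exact: cvg_cst.
exact: cvg_id.
Qed.

Lemma slice_cvg m (g : 'rV[R]_m.+1 -> R) (u : nat -> R) x v :
  continuous g -> u @ \oo --> x ->
  slice g (u k) v @[k --> \oo] --> slice g x v.
Proof.
move=> cg ux.
apply: (cvg_comp (fun k => row_mx (const_mx (u k) : 'rV[R]_1) v) g) (cg _).
by apply: row_mx_const_cvg => //; exact: cvg_cst.
Qed.

Lemma Rintegral_normal_cst (a : R) : Rintegral N01 setT (cst a) = a.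
Proof.
by rewrite Rintegral_cst//= /normal_prob integral_normal_pdf mulr1.
Qed.

(** The two claims need a joint induction: convergence in dimension m makes the slice expectations
    continuous in x, hence measurable, and the bound dominates them, so that dominated convergence
    applies in dimension m + 1. *)
Lemma gauss_exp_bound_cvg m :
  (forall (g : 'rV[R]_m -> R) M, continuous g -> (forall v, `|g v| <= M) ->
    `|gauss_exp g| <= M) /\
  (forall (g_ : nat -> 'rV[R]_m -> R) g M, (forall k, continuous (g_ k)) ->
    continuous g -> (forall k v, `|g_ k v| <= M) ->
    (forall v, g_ k v @[k --> \oo] --> g v) ->
    gauss_exp (g_ k) @[k --> \oo] --> gauss_exp g).
Proof.
elim: m => [|m [IHb IHc]]; first by split=> [g M _|g_ g M _ _ _]; exact.
have cont_slice (g : 'rV[R]_m.+1 -> R) M : continuous g ->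
    (forall v, `|g v| <= M) -> continuous (fun x => gauss_exp (slice g x)).
  move=> cg gM x; apply/(@cvg_nbhsP _ R^o) => u ux.
  apply: (IHc _ _ M) => [k|||v].
  - exact: slice_continuous.
  - exact: slice_continuous.
  - by move=> k v; exact: gM.
  - exact: slice_cvg.
split=> [g M cg gM|g_ g M cg_ cg gM gcv]; rewrite gauss_expS.
  have bs x : `|gauss_exp (slice g x)| <= M.
    by apply: IHb => [|v]; [exact: slice_continuous|exact: gM].
  have ms : measurable_fun setT (fun x => gauss_exp (slice g x)).
    by apply: continuous_measurable_fun; exact: cont_slice gM.
  apply: le_trans (le_normr_Rintegral _ _) _ => //.
    exact: integrable_normal_bounded bs.
  apply: le_trans (le_Rintegral (f2 := cst M) _ _ _ _) _ => //.
  - exact: (integrable_abse (integrable_normal_bounded ms bs)).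
  - exact: finite_measure_integrable_cst.
  - by rewrite Rintegral_normal_cst.
apply: (@Rintegral_dominated_cvg _ _ R N01 (fun k x => gauss_exp (slice (g_ k) x)) _ (cst M)).
- by move=> k; apply: continuous_measurable_fun; exact: (cont_slice _ M).
- move=> x; apply: (IHc _ _ M) => [k|||v].
  + exact: slice_continuous.
  + exact: slice_continuous.
  + by move=> k v; exact: gM.
  + exact: gcv.
- exact: finite_measure_integrable_cst.
- by move=> k x; apply: IHb => [|v]; [exact: slice_continuous|exact: gM].
Qed.

Lemma gauss_exp_norm_le m (g : 'rV[R]_m -> R) M : continuous g ->
  (forall v, `|g v| <= M) -> `|gauss_exp g| <= M.
Proof. by have [h _] := gauss_exp_bound_cvg m; exact: h. Qed.

Lemma gauss_exp_cvg m (g_ : nat -> 'rV[R]_m -> R) g M :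
  (forall k, continuous (g_ k)) -> continuous g ->
  (forall k v, `|g_ k v| <= M) -> (forall v, g_ k v @[k --> \oo] --> g v) ->
  gauss_exp (g_ k) @[k --> \oo] --> gauss_exp g.
Proof. by have [_ h] := gauss_exp_bound_cvg m; exact: h. Qed.

(** Linearity and monotonicity of [Rintegral] ask for integrability at each layer of the iterated
    integral; continuity and a bound provide it and pass to slices. *)
Lemma integrable_gauss_slice m (g : 'rV[R]_m.+1 -> R) M : continuous g ->
  (forall v, `|g v| <= M) ->
  N01.-integrable setT (EFin \o (fun x => gauss_exp (slice g x))).
Proof.
move=> cg gM; apply: (@integrable_normal_bounded _ _ M); last first.
  move=> x; apply: gauss_exp_norm_le; first exact: slice_continuous.
  by move=> v; exact: gM.
apply: continuous_measurable_fun => x; apply/(@cvg_nbhsP _ R^o) => u ux.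
apply: (gauss_exp_cvg (M := M)) => [k|||v].
- exact: slice_continuous.
- exact: slice_continuous.
- by move=> k v; exact: gM.
- exact: slice_cvg.
Qed.

Lemma gauss_expD m (g h : 'rV[R]_m -> R) M1 M2 : continuous g -> continuous h ->
  (forall v, `|g v| <= M1) -> (forall v, `|h v| <= M2) ->
  gauss_exp (fun v => g v + h v) = gauss_exp g + gauss_exp h.
Proof.
elim: m g h => [//|m IH] g h cg ch gM hM.
rewrite !gauss_expS -(RintegralD measurableT); first last.
- exact: integrable_gauss_slice hM.
- exact: integrable_gauss_slice gM.
apply: eq_Rintegral => x _; rewrite -IH//; try exact: slice_continuous.
  by move=> v; exact: gM.
by move=> v; exact: hM.
Qed.

Lemma gauss_expZ m (g : 'rV[R]_m -> R) M a : continuous g ->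
  (forall v, `|g v| <= M) ->
  gauss_exp (fun v => a * g v) = a * gauss_exp g.
Proof.
elim: m g => [//|m IH] g cg gM.
rewrite !gauss_expS -(RintegralZl _ measurableT); last first.
  exact: integrable_gauss_slice gM.
apply: eq_Rintegral => x _; rewrite -IH//; first exact: slice_continuous.
by move=> v; exact: gM.
Qed.

Lemma ler_gauss_exp m (g h : 'rV[R]_m -> R) M1 M2 :
  continuous g -> continuous h ->
  (forall v, `|g v| <= M1) -> (forall v, `|h v| <= M2) ->
  (forall v, g v <= h v) -> gauss_exp g <= gauss_exp h.
Proof.
elim: m g h => [|m IH] g h cg ch gM hM gh; first exact: gh.
rewrite !gauss_expS; apply: le_Rintegral => //.
- exact: integrable_gauss_slice gM.
- exact: integrable_gauss_slice hM.
move=> x _; apply: IH; try exact: slice_continuous.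
- by move=> v; exact: gM.
- by move=> v; exact: hM.
- by move=> v; exact: gh.
Qed.

Lemma gauss_exp_cst m (a : R) : gauss_exp (fun _ : 'rV[R]_m => a) = a.
Proof.
elim: m => [//|m IH]; rewrite gauss_expS (eq_Rintegral N01 (g := cst a)).
  by rewrite Rintegral_normal_cst.
by move=> x _; exact: IH.
Qed.

(** For a fixed first coordinate x the induction hypothesis is applied with phase al + a_0 x, which
    is why the phase is general; the one-dimensional formula then integrates over x. *)
Lemma gauss_exp_cos m (a : 'rV[R]_m) (al : R) :
  gauss_exp (fun u => cos (al + dotv a u)) =
  cos al * expR (- ((\sum_i a 0 i ^+ 2) / 2)).
Proof.
elim: m a al => [|m IH] a al.
  by rewrite /dotv /= !big_ord0 mul0r oppr0 expR0 addr0 mulr1.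
pose a' : 'rV[R]_m := \row_j a 0 (lift ord0 j).
rewrite gauss_expS (eq_Rintegral N01 (g := fun x =>
    expR (- ((\sum_i a' 0 i ^+ 2) / 2)) * cos (al + a 0 ord0 * x))); last first.
  move=> x _; rewrite mulrC -IH; congr gauss_exp; apply/funext => v.
  rewrite /slice /dotv big_ord_recl addrA; congr (cos (_ + _ * _ + _)).
    by rewrite mxE; case: splitP => // j _; rewrite mxE.
  apply: eq_bigr => j _; rewrite !mxE; congr (_ * _).
  case: splitP => [k|k /= /eqP]; first by rewrite [k]ord1.
  by rewrite eqSS => /eqP/ord_inj ->.
rewrite RintegralZl//; last first.
  apply: (@integrable_normal_bounded _ _ 1); last by move=> x; exact: cos_max.
  by apply: continuous_measurable_fun; exact: continuous_cos_affine.
rewrite normal_prob_cos mulrCA -expRD big_ord_recl; congr (_ * expR _).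
under eq_bigr do rewrite mxE.
by field.
Qed.

End gaussian_expectation.

(** * Approximation by trigonometric polynomials *)

Section trigonometric_polynomials.
Variables (R : realType) (n : nat) (l : R).

(** The phase is free, so sines are included. Boundedness, continuity and convergence of
    expectations are then proved by induction on the construction. *)
Inductive trigpoly : ('rV[R]_n -> R) -> Prop :=
| trig_cos (k : 'rV[int]_n) (al : R) :
    trigpoly (fun y => cos (al + dotv (l *: zr R k) y))
| trig_add g h : trigpoly g -> trigpoly h -> trigpoly (fun y => g y + h y)
| trig_scale a g : trigpoly g -> trigpoly (fun y => a * g y).

Lemma dotvDl (a b y : 'rV[R]_n) : dotv (a + b) y = dotv a y + dotv b y.
Proof.
by rewrite /dotv -big_split; apply: eq_bigr => i _; rewrite mxE mulrDl.
Qed.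

Lemma dotvNl (a y : 'rV[R]_n) : dotv (- a) y = - dotv a y.
Proof.
by rewrite /dotv -sumrN; apply: eq_bigr => i _; rewrite mxE mulNr.
Qed.

Lemma trig_cst a : trigpoly (fun=> a).
Proof.
have -> : (fun=> a) = (fun y : 'rV[R]_n => a * cos (0 + dotv (l *: zr R 0) y)).
  apply/funext => y; rewrite (_ : zr R 0 = 0); last first.
    by apply/rowP => i; rewrite !mxE.
  rewrite scaler0 /dotv big1 ?addr0 ?cos0 ?mulr1// => i _.
  by rewrite mxE mul0r.
exact/trig_scale/trig_cos.
Qed.

(** The product-to-sum formula needs the frequencies k + k' and k - k', which stay in the
    lattice. *)
Lemma trig_mul g h : trigpoly g -> trigpoly h -> trigpoly (fun y => g y * h y).
Proof.
move=> tg; elim: tg h => {g} [k al|g1 g2 _ IH1 _ IH2|a g _ IH] h th.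
- elim: th => {h} [k' al'|h1 h2 _ IH1 _ IH2|a h _ IH].
  + have -> : (fun y => cos (al + dotv (l *: zr R k) y) *
                 cos (al' + dotv (l *: zr R k') y)) =
      (fun y => 2^-1 * (cos ((al + al') + dotv (l *: zr R (k + k')) y) +
                        cos ((al - al') + dotv (l *: zr R (k - k')) y))).
      apply/funext => y.
      have zrN : zr R (- k') = - zr R k'.
        by apply/rowP => i; rewrite !mxE rmorphN.
      rewrite !zrD zrN !scalerDr scalerN !dotvDl dotvNl.
      set u := dotv _ _; set v := dotv _ _.
      have -> : al + al' + (u + v) = (al + u) + (al' + v) by ring.
      have -> : al - al' + (u - v) = (al + u) - (al' + v) by ring.
      by rewrite (cosD (al + u)) (cosB (al + u)); field.
    by apply/trig_scale/trig_add; exact: trig_cos.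
  + rewrite (_ : (fun _ => _) = (fun y => cos (al + dotv (l *: zr R k) y) * h1 y +
        cos (al + dotv (l *: zr R k) y) * h2 y)); first exact: trig_add.
    by apply/funext => y; rewrite mulrDr.
  + rewrite (_ : (fun _ => _) = (fun y => a * (cos (al + dotv (l *: zr R k) y) * h y))).
      exact: trig_scale.
    by apply/funext => y; rewrite mulrCA.
- rewrite (_ : (fun _ => _) = (fun y => g1 y * h y + g2 y * h y)).
    by apply: trig_add; [exact: IH1|exact: IH2].
  by apply/funext => y; rewrite mulrDl.
- rewrite (_ : (fun _ => _) = (fun y => a * (g y * h y))).
    by apply: trig_scale; exact: IH.
  by apply/funext => y; rewrite mulrA.
Qed.

Lemma trig_sum (I : Type) (r : seq I) (g : I -> 'rV[R]_n -> R) :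
  (forall i, trigpoly (g i)) -> trigpoly (fun y => \sum_(i <- r) g i y).
Proof.
move=> tg; elim: r => [|i r IH].
  rewrite (_ : (fun _ => _) = (fun=> 0)); first exact: trig_cst.
  by apply/funext => y; rewrite big_nil.
rewrite (_ : (fun _ => _) = (fun y => g i y + \sum_(i <- r) g i y)).
  exact: trig_add.
by apply/funext => y; rewrite big_cons.
Qed.

Lemma trig_prod (I : Type) (r : seq I) (g : I -> 'rV[R]_n -> R) :
  (forall i, trigpoly (g i)) -> trigpoly (fun y => \prod_(i <- r) g i y).
Proof.
move=> tg; elim: r => [|i r IH].
  rewrite (_ : (fun _ => _) = (fun=> 1)); first exact: trig_cst.
  by apply/funext => y; rewrite big_nil.
rewrite (_ : (fun _ => _) = (fun y => g i y * \prod_(i <- r) g i y)).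
  exact: trig_mul.
by apply/funext => y; rewrite big_cons.
Qed.

Lemma trig_sin i : trigpoly (fun y => sin (l * y 0 i)).
Proof.
rewrite (_ : (fun _ => _) =
    (fun y => cos (- (pi / 2) + dotv (l *: zr R (delta_mx 0 i)) y))).
  exact: trig_cos.
apply/funext => y; rewrite (_ : dotv _ _ = l * y 0 i).
  by rewrite addrC cosB cos_pihalf sin_pihalf mulr0 add0r mulr1.
rewrite /dotv (bigD1 i)//= big1 ?addr0 => [|j ji].
  by rewrite !mxE !eqxx mulr1.
by rewrite !mxE (negPf ji) mulr0 mul0r.
Qed.

Lemma trigpoly_bounded g : trigpoly g -> exists M, forall y, `|g y| <= M.
Proof.
elim=> [k al|g1 g2 _ [M1 h1] _ [M2 h2]|a g1 _ [M1 h1]].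
- by exists 1 => y; exact: cos_max.
- by exists (M1 + M2) => y; apply: le_trans (ler_normD _ _) _; exact: lerD.
- by exists (`|a| * M1) => y; rewrite normrM ler_wpM2l.
Qed.

Lemma dotv_continuous (a : 'rV[R]_n) : continuous (dotv a).
Proof.
rewrite /dotv; elim: (index_enum _) => [|i r IH] y.
  rewrite (_ : (fun _ => _) = cst 0); first exact: cst_continuous.
  by apply/funext => z; rewrite big_nil.
rewrite (_ : (fun _ => _) =
    (fun z : 'rV[R]_n => a 0 i * z 0 i + \sum_(j <- r) a 0 j * z 0 j)).
  exact: (cvgD (cvgM (cvg_cst (a 0 i)) (@coord_continuous_rV R n i y)) (IH y)).
by apply/funext => z; rewrite big_cons.
Qed.

Lemma trigpoly_continuous g : trigpoly g -> continuous g.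
Proof.
elim=> [k al|g1 g2 _ h1 _ h2|a g1 _ h1] y.
- apply: (cvg_comp (fun y => al + dotv (l *: zr R k) y) cos _ (@continuous_cos _ _)).
  exact: (cvgD (cvg_cst al) (@dotv_continuous (l *: zr R k) y)).
- exact: (cvgD (h1 y) (h2 y)).
- exact: (cvgM (cvg_cst a) (h1 y)).
Qed.

End trigonometric_polynomials.

(** Only [x] is confined to the cube. In the covering argument half of the radius of continuity
    bounds the distance to the centre, and the other half the tolerance. *)
Lemma cube_unif_continuous (R : realType) (n : nat) (F : 'rV[R]_n -> R) (eps : R) :
  continuous F -> 0 < eps -> exists2 de : R, 0 < de &
  forall x x' : 'rV[R]_n, (forall i, 0 <= x 0 i <= 1) ->
    (forall i, `|x 0 i - x' 0 i| < de) -> `|F x - F x'| < eps.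
Proof.
move=> cF eps0.
have K : compact [set x : 'rV[R]_n | forall i, `[0, 1]%classic (x ord0 i)].
  by apply: (@rV_compact R n (fun=> `[0, 1]%classic)) => i; exact: segment_compact.
move/compact_near_coveringP: K => /(_ R (0 : R)^'+
  (fun de x => forall x' : 'rV[R]_n, (forall i, `|x 0 i - x' 0 i| < de) -> `|F x - F x'| < eps)).
case.
- move=> x _; have /cvgrPdist_lt/(_ _ (divr_gt0 eps0 (ltr0Sn _ 1))) := cF x.
  move=> /nbhs_ballP[d /= d0 hd].
  exists ([set y | ball x (d / 2) y], [set de | de < d / 2]) => /=.
    split; first by apply: nbhsx_ballx; rewrite divr_gt0.
    by apply: nbhs_right_lt; rewrite divr_gt0.
  move=> [y de] [/= [_ xy] ded] x' yx'.
  have h1 : `|F x - F y| < eps / 2.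
    apply: hd; split=> // i j; apply: lt_trans (xy i j) _.
    by rewrite ltr_pdivrMr// ltr_pMr// ltr1n.
  have h2 : `|F x - F x'| < eps / 2.
    apply: hd; split=> // i j; rewrite [i]ord1 [d](splitr d).
    apply: le_lt_trans (ler_distD (y 0 j) _ _) _; apply: ltrD.
      exact: xy.
    exact: lt_trans (yx' j) ded.
  rewrite [eps]splitr; apply: le_lt_trans (ler_distD (F x) _ _) _.
  by rewrite distrC; exact: ltrD.
- move=> d /= d0 hd; exists (d / 2); first by rewrite divr_gt0.
  move=> x x' x01 xx'.
  apply: (hd (d / 2) _ _ x) => //=.
  + by rewrite sub0r normrN gtr0_norm ?divr_gt0// ltr_pdivrMr// ltr_pMr// ltr1n.
  + by rewrite divr_gt0.
Qed.

(** * Multivariate Bernstein polynomials as expectations over Bernoulli trials *)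

Section bernstein.
Variables (R : realType) (n m : nat).

(* [x i] is the success probability of the Bernoulli trials of row [i]. *)
Definition bern (x : 'rV[R]_n) (z : 'I_n * 'I_m.+1) (b : bool) : R :=
  if b then x 0 z.1 else 1 - x 0 z.1.

(** Success frequencies of the rows; the expectation of [F] at this random point is the Bernstein
    polynomial of [F] at [x]. *)
Definition bmean (v : {ffun 'I_n * 'I_m.+1 -> bool}) : 'rV[R]_n :=
  \row_i ((\sum_j (v (i, j))%:R) / m.+1%:R).

Variable x : 'rV[R]_n.
Hypothesis x01 : forall i, 0 <= x 0 i <= 1.

Lemma bern_ge0 z b : 0 <= bern x z b.
Proof. by have /andP[h0 h1] := x01 z.1; case: b; rewrite /bern ?subr_ge0. Qed.

Lemma bern_sum1 z : \sum_b bern x z b = 1.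
Proof. by rewrite big_bool /= addrC subrK. Qed.

(** [pexp_ar2] with w = 1 and B = 1 bounds the second moment of the sum of m + 1 centred trials by m
    + 1. *)
Lemma pexp_bmean_var i : pexp (bern x) (fun v => (bmean v 0 i - x 0 i) ^+ 2) <= m.+1%:R^-1.
Proof.
pose M (k : nat) (v : {ffun 'I_n * 'I_m.+1 -> bool}) : R :=
  (v (i, inord k))%:R - x 0 i.
pose F (k : nat) v := \sum_(0 <= j < k) M j v.
have FE v : (bmean v 0 i - x 0 i) ^+ 2 = m.+1%:R ^- 2 * F m.+1 v ^+ 2.
  rewrite /F big_mkord sumrB sumr_const card_ord mxE.
  under [in RHS]eq_bigr do rewrite inord_val.
  rewrite -mulr_natl; set s := \sum_j _.
  by field; rewrite nat1r pnatr_eq0.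
under eq_pexp do rewrite FE.
rewrite pexpZ; apply: le_trans (_ : m.+1%:R ^- 2 * (m.+1%:R * 1 ^+ 2) <= _).
  apply: ler_wpM2l; first by rewrite invr_ge0 exprn_ge0.
  apply: (pexp_ar2 bern_ge0 bern_sum1 (F := F) (M := M) (w := 1) (N := m.+1)) => //.
  - by move=> v; rewrite /F big_geq.
  - by move=> k v; rewrite /F big_nat_recr//= mul1r.
  - by rewrite ler01 lexx.
  - move=> k v; rewrite /M; have /andP[h0 h1] := x01 i.
    by case: (v _); rewrite /= ler_norml; lra.
  - move=> k km.
    apply: (pexp_indep0 bern_sum1 (z := (i, inord k)) (H := F k)
      (psi := fun b : bool => b%:R - x 0 i)).
      (* [F k] involves only the trials of index below k, so changing the trial (i, k) does not
         affect it. *)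
      move=> v b; rewrite /F !big_mkord; apply: eq_bigr => j _.
      rewrite /M /ffupd ffunE; case: eqP => // -[jk].
      have /(congr1 val) := jk; rewrite /= !inordK//; last first.
        exact: ltn_trans (ltn_ord j) km.
      by move=> jkE; have := ltn_ord j; rewrite jkE ltnn.
    by rewrite big_bool /= /bern; ring.
rewrite expr1n mulr1 le_eqVlt; apply/orP; left; apply/eqP.
by field; rewrite nat1r pnatr_eq0.
Qed.

(** Chebyshev: sample points within [de] of x cost eps; for the others some coordinate deviates by
    at least [de], so 2 M is at most 2 M / de^2 times its squared deviation, which has mean at most
    1/(m + 1). *)
Lemma bernstein_approx (F : 'rV[R]_n -> R) (M de eps : R) : 0 < de -> 0 <= eps ->
  (forall y, `|F y| <= M) ->
  (forall y : 'rV[R]_n, (forall i, `|x 0 i - y 0 i| < de) -> `|F x - F y| < eps) ->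
  `|F x - pexp (bern x) (fun v => F (bmean v))| <=
  eps + 2 * M * n%:R / (de ^+ 2 * m.+1%:R).
Proof.
move=> de0 eps0 FM Fde.
have M0 : 0 <= M by apply: le_trans (FM x).
have -> : F x - pexp (bern x) (fun v => F (bmean v)) =
    pexp (bern x) (fun v => F x - F (bmean v)).
  rewrite pexpD (pexp_cst bern_sum1); congr (_ + _).
  by rewrite -mulN1r -pexpZ; apply: eq_pexp => v; rewrite mulN1r.
pose C := 2 * M / de ^+ 2.
have C0 : 0 <= C by rewrite divr_ge0 ?sqr_ge0// mulr_ge0.
have pt v : `|F x - F (bmean v)| <=
    eps + \sum_i C * (bmean v 0 i - x 0 i) ^+ 2.
  have s0 i : 0 <= C * (bmean v 0 i - x 0 i) ^+ 2 by rewrite mulr_ge0 ?sqr_ge0.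
  have [/forallP h|] := boolP [forall i, `|x 0 i - bmean v 0 i| < de].
    by rewrite ler_wpDr ?sumr_ge0// ltW// Fde.
  rewrite negb_forall => /existsP[i]; rewrite -leNgt => dei.
  rewrite ler_wpDl//; apply: le_trans (_ : 2 * M <= _).
    by apply: le_trans (ler_normB _ _) _; have := FM x; have := FM (bmean v); lra.
  rewrite (bigD1 i)//=; apply: ler_wpDr; first by rewrite sumr_ge0.
  rewrite /C mulrAC ler_pdivlMr ?exprn_gt0// ler_wpM2l ?mulr_ge0//.
  rewrite -[leRHS]real_normK ?num_real// distrC lerXn2r ?nnegrE//; exact: ltW.
apply: le_trans (ler_norm_sum _ _ _) _.
apply: le_trans (_ : pexp (bern x) (fun v =>
  eps + \sum_i C * (bmean v 0 i - x 0 i) ^+ 2) <= _).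
  apply: ler_sum => v _.
  by rewrite normrM ger0_norm ?(pexp_weight_ge0 bern_ge0)// ler_wpM2l ?(pexp_weight_ge0 bern_ge0).
rewrite pexpD (pexp_cst bern_sum1) lerD2l pexp_sum.
apply: le_trans (_ : \sum_(i < n) C / m.+1%:R <= _).
  by apply: ler_sum => i _; rewrite pexpZ ler_wpM2l// pexp_bmean_var.
rewrite sumr_const card_ord -[leLHS]mulr_natl le_eqVlt; apply/orP; left; apply/eqP.
by rewrite /C; field; rewrite (gt_eqF de0) nat1r pnatr_eq0.
Qed.

End bernstein.

(** cos z >= 1 - z^2 >= 3/4 gives sin^2 z <= 7/16 < (3/4)^2. The value 3/4 is the level of [clip],
    strictly below 1. *)
Lemma normr_sin_le34 (R : realType) (z : R) : `|z| <= 1 / 2 -> `|sin z| <= 3 / 4.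
Proof.
move=> z2; have hc : 3 / 4 <= cos z.
  have := normr_1Bcos_le z; rewrite ler_norml => /andP[_].
  have : `|z| ^+ 2 <= (1 / 2) ^+ 2 by rewrite lerXn2r ?nnegrE// divr_ge0.
  by lra.
rewrite -(@ler_pXn2r _ 2)// ?nnegrE// real_normK ?num_real//.
have := cos2Dsin2 z; nra.
Qed.

(** * Approximation on a box without increase of the sup norm *)

Section trigonometric_approximation.
Variables (R : realType) (n : nat) (l : R).
Hypothesis l0 : 0 < l.

(** Truncation to [-3/4, 3/4], written with absolute values so that continuity is immediate. *)
Definition clip (t : R) : R := (`|t + 3 / 4| - `|t - 3 / 4|) / 2.

Lemma clip_le t : `|clip t| <= 3 / 4.
Proof.
rewrite /clip normrM [`|2^-1|]ger0_norm// ler_pdivrMr//.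
apply: le_trans (ler_dist_dist _ _) _.
by rewrite opprB addrA addrAC [t + _]addrC addrK ger0_norm; lra.
Qed.

Lemma clip_id t : `|t| <= 3 / 4 -> clip t = t.
Proof.
rewrite ler_norml => /andP[h1 h2]; rewrite /clip ger0_norm; last by lra.
by rewrite ler0_norm; [field|lra].
Qed.

Lemma clip_continuous : continuous clip.
Proof.
move=> t; apply: cvgM; last exact: cvg_cst.
apply: cvgB; apply: cvg_norm.
  by apply: cvgD; [exact: cvg_id|exact: cvg_cst].
by apply: cvgB; [exact: cvg_id|exact: cvg_cst].
Qed.

(* A continuous left inverse of [wind]; clipping keeps [asin] away from the
   end points of its domain, where it is not known to be continuous. *)
Definition unwind (x : R) : R := l^-1 * asin (clip (2 * x - 1)).

Lemma unwind_continuous : continuous unwind.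
Proof.
move=> x; apply: cvgM; first exact: cvg_cst.
apply: (cvg_comp (fun x => clip (2 * x - 1)) asin); last first.
  by apply: continuous_asin; have := clip_le (2 * x - 1); rewrite ler_norml; lra.
apply: (cvg_comp (fun x => 2 * x - 1) clip _ (@clip_continuous _)).
apply: cvgB; last exact: cvg_cst.
by apply: cvgMl_tmp; exact: cvg_id.
Qed.

Definition wind (y : 'rV[R]_n) : 'rV[R]_n := \row_i ((1 + sin (l * y 0 i)) / 2).

Lemma wind01 y i : 0 <= wind y 0 i <= 1.
Proof.
by have := sin_max (l * y 0 i); rewrite mxE ler_norml; lra.
Qed.

Lemma unwindK (y : 'rV[R]_n) i : `|l * y 0 i| <= 1 / 2 -> unwind (wind y 0 i) = y 0 i.
Proof.
move=> h; rewrite /unwind mxE.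
have -> : 2 * ((1 + sin (l * y 0 i)) / 2) - 1 = sin (l * y 0 i) by field.
rewrite clip_id ?normr_sin_le34// sinK ?mulKf ?gt_eqF//.
by rewrite in_itv/=; move: h (pi_ge2 R); rewrite ler_norml; lra.
Qed.

(* Bernstein polynomials in the variables [(1 + sin (l y_i)) / 2]: unlike
   ordinary polynomials they stay bounded by [M] outside the box. *)
Lemma trigpoly_approx (f : 'rV[R]_n -> R) (M eps : R) :
  continuous f -> (forall y, `|f y| <= M) -> 0 < eps ->
  exists2 g, trigpoly l g &
    (forall y, `|g y| <= M) /\
    (forall y : 'rV[R]_n, (forall i, `|l * y 0 i| <= 1 / 2) -> `|f y - g y| <= eps).
Proof.
move=> cf fM eps0.
(* [F] is continuous on the whole space since [unwind] is, and F (wind y) = f y for y in the box. *)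
pose F (x : 'rV[R]_n) := f (\row_i unwind (x 0 i)).
have cF : continuous F.
  move=> x.
  have cw : (\row_i unwind (y 0 i) : 'rV[R]_n) @[y --> x] -->
      (\row_i unwind (x 0 i) : 'rV[R]_n).
    apply: (@cvg_rV _ _ (nbhs x)) => i.
    rewrite mxE; under eq_fun do rewrite mxE.
    exact: (cvg_comp (fun x : 'rV[R]_n => x 0 i) unwind
      (@coord_continuous_rV R n i x) (@unwind_continuous _)).
  exact: (cvg_comp _ f cw (cf _)).
have FM x : `|F x| <= M by exact: fM.
have M0 : 0 <= M by apply: le_trans (fM 0).
have e2 : 0 < eps / 2 by rewrite divr_gt0.
have [de de0 hde] := cube_unif_continuous cF e2.
have [m hm] : exists m : nat, 2 * M * n%:R / (de ^+ 2 * m.+1%:R) <= eps / 2.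
  pose a := 2 * M * n%:R / de ^+ 2.
  have a0 : 0 <= a by rewrite divr_ge0 ?sqr_ge0// !mulr_ge0.
  (* Makes m + 1 exceed a / (eps / 2), so the Chebyshev term is at most eps / 2. *)
  exists (Num.truncn (a / (eps / 2))).
  have h : a / (eps / 2) < (Num.truncn (a / (eps / 2))).+1%:R.
    by apply: truncnS_gt.
  rewrite ltr_pdivrMr// in h.
  rewrite invfM mulrA -/a ler_pdivrMr//.
  by rewrite mulrC; exact: ltW.
exists (fun y => pexp (bern (m := m) (wind y)) (fun v => F (bmean R v))); last split.
- rewrite /pexp; apply: trig_sum => v.
  rewrite (_ : (fun _ => _) = (fun y => F (bmean R v) *
    \prod_(z : 'I_n * 'I_m.+1) bern (wind y) z (v z))); last first.
    by apply/funext => y; rewrite mulrC.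
  apply/trig_scale/trig_prod => z; rewrite /bern.
  have tw : trigpoly l (fun y => wind y 0 z.1).
    rewrite (_ : (fun _ => _) = (fun y : 'rV[R]_n => 2^-1 * (1 + sin (l * y 0 z.1)))).
      apply/trig_scale/trig_add; first exact: trig_cst.
      exact: trig_sin.
    by apply/funext => y; rewrite mxE mulrC.
  case: (v z) => //.
  rewrite (_ : (fun _ => _) = (fun y => 1 + (-1) * wind y 0 z.1)).
    by apply: trig_add; [exact: trig_cst|exact: trig_scale].
  by apply/funext => y; rewrite mulN1r.
- move=> y; apply: pexp_norm_le => [z b|z|v]; last exact: FM.
    by apply: bern_ge0 => i; exact: wind01.
  exact: bern_sum1.
- move=> y hy.
  have -> : f y = F (wind y).
    by congr f; apply/rowP => i; rewrite mxE unwindK.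
  have w01 := wind01 y.
  apply: le_trans (bernstein_approx m w01 de0 (ltW e2) FM _) _.
    by move=> x'; apply: hde.
  by rewrite [leRHS]splitr lerD2l.
Qed.

End trigonometric_approximation.

(** * The quenched central limit theorem *)

Lemma invsqrt_cvg0 (R : realType) : (Num.sqrt (t%:R : R))^-1 @[t --> \oo] --> 0.
Proof.
have -> : (fun t : nat => (Num.sqrt (t%:R : R))^-1) =
    (fun t : nat => Num.sqrt (t%:R^-1 : R)).
  by apply/funext => t; rewrite sqrtrV.
rewrite -[X in _ --> X]sqrtr0; apply: (cvg_comp (fun t : nat => t%:R^-1 : R)
  Num.sqrt _ (@sqrt_continuous _ _)).
rewrite -(cvg_shiftS (fun t : nat => (t%:R : R)^-1)).
exact: cvg_harmonic.
Qed.

(* A bounded continuous function below [8 t ^ 2] and above the indicator of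
   [1/2 < |t|], so it controls tails both of the walk (by second moments) and of
   the Gaussian (by dominated convergence). *)
Definition bump (R : realType) (t : R) : R := 8 * t ^+ 2 / (1 + 4 * t ^+ 2).

Section bump.
Variable R : realType.
Implicit Type t : R.

Let den_gt0 t : 0 < 1 + 4 * t ^+ 2.
Proof. by have := sqr_ge0 t; lra. Qed.

Lemma bump_ge0 t : 0 <= bump t.
Proof. by rewrite divr_ge0 ?(ltW (den_gt0 t))// mulr_ge0// sqr_ge0. Qed.

Lemma bump_le2 t : bump t <= 2.
Proof. by rewrite ler_pdivrMr ?den_gt0//; lra. Qed.

Lemma bump_le_sqr t : bump t <= 8 * t ^+ 2.
Proof.
rewrite ler_pdivrMr ?den_gt0//; have t2 := sqr_ge0 t.
by rewrite ler_peMr//; lra.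
Qed.

Lemma bump_ge1 t : 1 / 2 < `|t| -> 1 <= bump t.
Proof.
move=> h; rewrite ler_pdivlMr ?den_gt0// mul1r.
have : (1 / 2) ^+ 2 <= `|t| ^+ 2 by rewrite lerXn2r ?nnegrE ?divr_ge0// ltW.
by rewrite real_normK ?num_real//; lra.
Qed.

Lemma bump_continuous : continuous (@bump R).
Proof.
move=> t; have c2 : (x : R) ^+ 2 @[x --> t] --> t ^+ 2 by exact: exprn_continuous.
apply: cvgM; first by apply: cvgMl_tmp.
apply: cvgV; first by rewrite gt_eqF.
by apply: cvgD; [exact: cvg_cst|exact: cvgMl_tmp].
Qed.

End bump.

Lemma scale_continuous (R : realType) (n : nat) (a : R) (g : 'rV[R]_n -> R) :
  continuous g -> continuous (fun u => a * g u).
Proof. by move=> cg u; exact: (cvgM (cvg_cst a) (cg u)). Qed.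

Section quenched_limit.
Variables (R : realType) (n : nat) (S : finType).
Variables (P0 : 'rV[int]_n -> R) (c : 'rV[int]_n -> S -> R).
Variables (x0 : 'rV[int]_n) (U : seq 'rV[int]_n) (b : 'rV[R]_n).
Hypothesis uniqU : uniq U.
Hypothesis stepU : forall u s, u \notin U -> P0 u + c u s = 0.
Hypothesis step01 : forall u s, 0 <= P0 u + c u s <= 1.
Hypothesis step_sum1 : forall s, \sum_(u <- U) (P0 u + c u s) = 1.
Hypothesis step_mean : forall s,
  \sum_(u <- U) (P0 u + c u s) *: (zr R u - b) = 0.
Variable A : 'M[R]_n.
Hypothesis cov : forall th, \sum_i (th *m A^T) 0 i ^+ 2 = var0 P0 U b th.

Local Notation rt t := (Num.sqrt (t%:R : R))^-1.
Local Notation E := (qexp P0 c x0 U).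

Let step_ge0 u s : 0 <= P0 u + c u s.
Proof. by have /andP[] := step01 u s. Qed.

Let var_ge0 th : 0 <= var0 P0 U b th.
Proof. by rewrite -cov sumr_ge0// => i _; exact: sqr_ge0. Qed.

Definition scaled (t : nat) (y : 'rV[int]_n) : 'rV[R]_n :=
  rt t *: (zr R y - t%:R *: b).

(** With k = t and r = t^(-1/2), the t-th power of the decay factor is exactly exp(-var0 / 2), the
    initial phase tends to al and the expansion error is C t^(-1/2). *)
Lemma qexp_wave_cvg th al e :
  fluct P0 c x0 U b th (rt t) al e t @[t --> \oo] --> 0 ->
  E e t (wave b th (rt t) al t) @[t --> \oo] --> cos al * expR (- (var0 P0 U b th / 2)).
Proof.
move=> fl0; set C := (\sum_(u <- U) (`|incr b th u| ^+ 4 + `|incr b th u| ^+ 3) +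
     var0 P0 U b th ^+ 2).
pose a t := expR (- (var0 P0 U b th / 2)) * wave b th (rt t) al 0 x0.
have ca : a t @[t --> \oo] --> cos al * expR (- (var0 P0 U b th / 2)).
  rewrite mulrC; apply: cvgMl_tmp; rewrite /wave.
  set z := dotv _ _.
  have cz : al + rt t * z @[t --> \oo] --> al + 0 * z.
    apply: cvgD; first exact: cvg_cst.
    by apply: cvgM; [exact: invsqrt_cvg0|exact: cvg_cst].
  rewrite mul0r addr0 in cz.
  exact: (cvg_comp _ cos cz (@continuous_cos _ _)).
have cr : C * rt t @[t --> \oo] --> 0.
  by rewrite -[X in _ --> X](mulr0 C); apply: cvgMl_tmp; exact: invsqrt_cvg0.
apply/subr_cvg0.
pose d t := E e t (wave b th (rt t) al t) - a t - fluct P0 c x0 U b th (rt t) al e t.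
have cd : d t @[t --> \oo] --> 0.
  apply: norm_cvg0; apply: (@squeeze_cvgr _ _ _ _ (cst 0) (fun t => C * rt t)) => //.
    near=> t; rewrite normr_ge0 /=.
    (* At t = 0 the convention 0^-1 = 0 breaks t r^2 = 1. *)
    have t0 : (0 < t)%N by near: t; exact: nbhs_infty_gt.
    have r2 : (rt t) ^+ 2 = t%:R^-1 := invsqrt_sqr R t.
    have tn0 : t%:R != 0 :> R by rewrite pnatr_eq0 -lt0n.
    have := qexp_wave_fluct x0 uniqU stepU step01 step_sum1 step_mean al e t
      (invsqrt01 R t) (var_ge0 th).
    rewrite r2 -expRM_natl.
    rewrite (_ : t%:R * - (t%:R^-1 * var0 P0 U b th / 2) = - (var0 P0 U b th / 2)); last first.
      by field.
    rewrite -/C (_ : t%:R * (C * rt t ^+ 3) = C * rt t)//.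
    set r := rt t in r2 *.
    have -> : t%:R * (C * r ^+ 3) = C * r * (t%:R * r ^+ 2) by ring.
    by rewrite r2 divff// mulr1.
  exact: cvg_cst.
have -> : (fun t => E e t (wave b th (rt t) al t) - cos al * expR (- (var0 P0 U b th / 2))) =
    (fun t => d t + fluct P0 c x0 U b th (rt t) al e t +
      (a t - cos al * expR (- (var0 P0 U b th / 2)))).
  by apply/funext => t; rewrite /d; ring.
rewrite -[X in _ --> X]addr0; apply: cvgD; last exact/subr_cvg0.
by rewrite -[X in _ --> X]addr0; apply: cvgD.
Unshelve. all: by end_near. Qed.

Lemma wave_scaled th al t y :
  wave b th (rt t) al t y = cos (al + dotv th (scaled t y)).
Proof. by rewrite /wave /scaled dotvZ. Qed.

Lemma dotv_mulmx (th u : 'rV[R]_n) : dotv th (u *m A) = dotv (th *m A^T) u.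
Proof.
rewrite /dotv; under eq_bigr do rewrite mxE mulr_sumr.
rewrite exchange_big; apply: eq_bigr => j _ /=.
rewrite mxE mulr_suml; apply: eq_bigr => i _.
by rewrite mxE; ring.
Qed.

Lemma mulmx_continuous : continuous (fun u : 'rV[R]_n => u *m A).
Proof.
move=> u; apply: (@cvg_rV _ _ (nbhs u)) => i.
have -> : (fun v : 'rV[R]_n => (v *m A) 0 i) = dotv (\row_j A j i).
  by apply/funext => v; rewrite mxE; apply: eq_bigr => j _; rewrite mxE mulrC.
have -> : (u *m A) 0 i = dotv (\row_j A j i) u.
  by rewrite mxE; apply: eq_bigr => j _; rewrite mxE mulrC.
exact: dotv_continuous.
Qed.

Let comp_continuous (g : 'rV[R]_n -> R) : continuous g ->
  continuous (fun u : 'rV[R]_n => g (u *m A)).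
Proof. by move=> cg u; exact: (cvg_comp _ g (@mulmx_continuous u) (cg _)). Qed.

Lemma gauss_exp_cosA th al : gauss_exp (fun u => cos (al + dotv th (u *m A))) =
  cos al * expR (- (var0 P0 U b th / 2)).
Proof.
under [in LHS]eq_fun do rewrite dotv_mulmx.
by rewrite gauss_exp_cos cov.
Qed.

Variable e : 'rV[int]_n -> nat -> S.
Hypothesis fluct0 : forall (L : nat) (k : 'rV[int]_n) (q : bool),
  fluct P0 c x0 U b (L.+1%:R^-1 *: zr R k) (rt t) (if q then - (pi / 2) else 0) e t
    @[t --> \oo] --> 0.

Lemma trigpoly_cvg (L : nat) g : trigpoly (L.+1%:R^-1) g ->
  E e t (fun y => g (scaled t y)) @[t --> \oo] --> gauss_exp (fun u => g (u *m A)).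
Proof.
elim=> [k al|g1 g2 tg1 h1 tg2 h2|a g1 tg1 h1].
- rewrite gauss_exp_cosA; set th := _ *: _.
  have h0 := qexp_wave_cvg (fluct0 L k false).
  have h1 := qexp_wave_cvg (fluct0 L k true).
  rewrite /= -/th cos0 mul1r in h0; rewrite /= -/th cosN cos_pihalf mul0r in h1.
  (* cos(al + z) = cos al cos z - sin al sin z, so the phases 0 and -pi/2 yield every phase. *)
  have -> : (fun t => E e t (fun y => cos (al + dotv th (scaled t y)))) =
    (fun t => cos al * E e t (wave b th (rt t) 0 t) +
              (- sin al) * E e t (wave b th (rt t) (- (pi / 2)) t)).
    apply/funext => t; rewrite -!qexpZ -qexpD; apply: eq_qexp => y.
    rewrite !wave_scaled add0r [- _ + _]addrC cosB cos_pihalf sin_pihalf cosD.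
    by ring.
  rewrite -[X in _ --> X]addr0 -[X in _ + X](mulr0 (- sin al)).
  by apply: cvgD; exact: cvgMl_tmp.
- have [M1 b1] := trigpoly_bounded tg1; have [M2 b2] := trigpoly_bounded tg2.
  rewrite (@gauss_expD _ _ (fun u => g1 (u *m A)) (fun u => g2 (u *m A)) M1 M2)//.
  + have -> : (fun t => E e t (fun y => g1 (scaled t y) + g2 (scaled t y))) =
      (fun t => E e t (fun y => g1 (scaled t y)) + E e t (fun y => g2 (scaled t y))).
      by apply/funext => t; rewrite qexpD.
    exact: cvgD.
  + exact/comp_continuous/(trigpoly_continuous tg1).
  + exact/comp_continuous/(trigpoly_continuous tg2).
- have [M1 b1] := trigpoly_bounded tg1.
  rewrite (@gauss_expZ _ _ (fun u => g1 (u *m A)) M1)//; last first.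
    exact/comp_continuous/(trigpoly_continuous tg1).
  have -> : (fun t => E e t (fun y => a * g1 (scaled t y))) =
      (fun t => a * E e t (fun y => g1 (scaled t y))).
    by apply/funext => t; rewrite qexpZ.
  exact: cvgMl_tmp.
Qed.

(** At least 1 off the box on which [trigpoly_approx] is accurate, yet continuous and bounded, so
    that Gaussian expectations of it make sense. *)
Definition far (l : R) (y : 'rV[R]_n) : R := \sum_i bump (l * y 0 i).

Lemma far_ge0 l y : 0 <= far l y.
Proof. by rewrite sumr_ge0// => i _; exact: bump_ge0. Qed.

Lemma far_le l y : far l y <= 2 * n%:R.
Proof.
apply: le_trans (_ : \sum_(i < n) 2 <= _).
  by apply: ler_sum => i _; exact: bump_le2.
by rewrite sumr_const card_ord mulr_natr.
Qed.

Lemma far_ge1 l (y : 'rV[R]_n) i : 1 / 2 < `|l * y 0 i| -> 1 <= far l y.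
Proof.
move=> h; rewrite /far (bigD1 i)//=; apply: ler_wpDr; last exact: bump_ge1.
by rewrite sumr_ge0// => j _; exact: bump_ge0.
Qed.

Lemma far_continuous l : continuous (far l).
Proof.
rewrite /far; elim: (index_enum _) => [|i r IH] y.
  rewrite (_ : (fun _ => _) = cst 0); first exact: cst_continuous.
  by apply/funext => z; rewrite big_nil.
rewrite (_ : (fun _ => _) =
    (fun z : 'rV[R]_n => bump (l * z 0 i) + \sum_(j <- r) bump (l * z 0 j))).
  apply: (cvgD _ (IH y)).
  have cl : l * z 0 i @[z --> y] --> l * y 0 i.
    exact: (cvgM (cvg_cst l) (@coord_continuous_rV R n i y)).
  exact: (cvg_comp _ (@bump R) cl (@bump_continuous _ _)).
by apply/funext => z; rewrite big_cons.
Qed.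

(** Tightness: second moments grow at most linearly in t and the scaling divides them by t, so the
    bound is uniform in t >= 1 and of order l^2. *)
Lemma qexp_far (l : R) t : (0 < t)%N ->
  E e t (fun y => far l (scaled t y)) <=
  l ^+ 2 * (8 * \sum_i (zr R x0 0 i ^+ 2 + \sum_(u <- U) (zr R u - b) 0 i ^+ 2)).
Proof.
move=> t0; have tR : 0 < t%:R :> R by rewrite ltr0n.
apply: le_trans (_ : E e t (fun y => \sum_i 8 * l ^+ 2 * t%:R^-1 *
    (zr R y - t%:R *: b) 0 i ^+ 2) <= _).
  apply: ler_qexp => // y; apply: ler_sum => i _.
  apply: le_trans (bump_le_sqr _) _; rewrite /scaled mxE.
  by rewrite -(invsqrt_sqr R t) le_eqVlt; apply/orP; left; apply/eqP; ring.
rewrite /qexp; under eq_bigr do rewrite mulr_sumr.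
rewrite exchange_big /= !mulr_sumr; apply: ler_sum => i _.
have := qexp_coord2 x0 uniqU stepU step01 step_sum1 step_mean e t i.
rewrite -/(qexp P0 c x0 U e t (fun y => 8 * l ^+ 2 * t%:R^-1 *
    (zr R y - t%:R *: b) 0 i ^+ 2)) qexpZ.
set X := qexp _ _ _ _ _ _ _; set x2 := zr R x0 0 i ^+ 2; set s2 := \sum_(u <- U) _.
move=> hX; have l2 := sqr_ge0 l.
have x20 : 0 <= x2 by exact: sqr_ge0.
apply: le_trans (_ : 8 * l ^+ 2 * t%:R^-1 * (x2 + t%:R * s2) <= _).
  by rewrite ler_wpM2l// mulr_ge0 ?invr_ge0// mulr_ge0.
have -> : 8 * l ^+ 2 * t%:R^-1 * (x2 + t%:R * s2) =
    l ^+ 2 * (8 * (t%:R^-1 * x2 + s2)) by field; rewrite gt_eqF.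
rewrite ler_wpM2l// ler_wpM2l// lerD2r ler_piMl//.
by rewrite invf_le1// ler1n.
Qed.

(** The integrands are at most 2 n and tend to 0 pointwise, so dominated convergence replaces a
    computation of Gaussian moments. *)
Lemma gauss_exp_far_cvg0 :
  gauss_exp (fun u => far (L.+1%:R^-1) (u *m A)) @[L --> \oo] --> 0.
Proof.
rewrite -[X in _ --> X](@gauss_exp_cst R n 0).
apply: (gauss_exp_cvg (M := 2 * n%:R)).
- by move=> L; exact/comp_continuous/far_continuous.
- exact: cst_continuous.
- by move=> L v; rewrite ger0_norm ?far_ge0// far_le.
(* Written as the value at scale 0, the limit follows from the continuity of [bump]. *)
- move=> v; have -> : 0 = far 0 (v *m A).
    rewrite /far big1// => i _.
    by rewrite mul0r /bump expr0n mulr0 mul0r.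
  rewrite /far; elim: (index_enum _) => [|i r IH].
    under eq_fun do rewrite big_nil.
    by rewrite big_nil; exact: cvg_cst.
  under eq_fun do rewrite big_cons.
  rewrite big_cons; apply: (cvgD _ IH).
  have cl : k.+1%:R^-1 * (v *m A) 0 i @[k --> \oo] --> 0 * (v *m A) 0 i.
    exact: (cvgM (@cvg_harmonic R) (cvg_cst ((v *m A) 0 i))).
  exact: (cvg_comp _ (@bump R) cl (@bump_continuous _ _)).
Qed.

(** Order of choices: L, making both tails small; then g with frequencies in (1/(L + 1)) Z^n; then
    t. The five parts of eps are an approximation error and a tail for each of the two laws, and the
    convergence for g. *)
Lemma quenched_conv_law_gauss :
  conv_law_gauss (fun t => qlaw P0 c e x0 t) scaled A.
Proof.
move=> f cf [M fM].
have -> : (fun t : nat => \sum_(y \in [set: 'rV[int]_n])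
      qlaw P0 c e x0 t y * f (scaled t y)) =
    (fun t => E e t (fun y => f (scaled t y))).
  by apply/funext => t; rewrite (fsum_qlaw _ stepU).
have M0 : 0 <= M by apply: le_trans (fM 0).
set D := (8 * \sum_i (zr R x0 0 i ^+ 2 + \sum_(u <- U) (zr R u - b) 0 i ^+ 2)).
have D0 : 0 <= D.
  rewrite mulr_ge0// sumr_ge0// => i _; rewrite addr_ge0 ?sqr_ge0//.
  by rewrite sumr_ge0// => u _; rewrite sqr_ge0.
apply/cvgrPdist_le => eps eps0.
have e5 : 0 < eps / 5 by rewrite divr_gt0.
have [L _ hL] : \forall L \near \oo,
    2 * M * gauss_exp (fun u => far (L.+1%:R^-1) (u *m A)) < eps / 5 /\
    2 * M * (L.+1%:R^-1 ^+ 2 * D) < eps / 5.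
  have c1 : 2 * M * gauss_exp (fun u => far (L.+1%:R^-1) (u *m A)) @[L --> \oo] --> 0.
    rewrite -[X in _ --> X](mulr0 (2 * M)).
    by apply: cvgMl_tmp; exact: gauss_exp_far_cvg0.
  have c2 : 2 * M * ((L.+1%:R^-1 : R) ^+ 2 * D) @[L --> \oo] --> 0.
    rewrite -[X in _ --> X](mulr0 (2 * M)); apply: cvgMl_tmp.
    rewrite -[X in _ --> X](mul0r D); apply: cvgM; last exact: cvg_cst.
    rewrite -[X in _ --> X](mulr0 0); under eq_fun do rewrite expr2.
    by apply: cvgM; exact: cvg_harmonic.
  by near=> L; split; near: L; [exact: (cvgr_lt _ c1)|exact: (cvgr_lt _ c2)].
have [hL1 hL2] := hL L (leqnn L).
set l : R := L.+1%:R^-1 in hL1 hL2.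
have l0 : 0 < l by rewrite invr_gt0.
have [g tg [gM fg]] := trigpoly_approx l0 cf fM e5.
have cg := trigpoly_continuous tg.
(* Off the box |f - g| <= 2 M, because g obeys the same bound M as f, and [far] is at least 1
   there. *)
have fgfar y : `|f y - g y| <= eps / 5 + 2 * M * far l y.
  have [/forallP h|] := boolP [forall i, `|l * y 0 i| <= 1 / 2].
    by rewrite ler_wpDr ?mulr_ge0 ?far_ge0// fg.
  rewrite negb_forall => /existsP[i]; rewrite -ltNge => /far_ge1 h.
  rewrite ler_wpDl ?(ltW e5)//; apply: le_trans (_ : 2 * M <= _).
    by apply: le_trans (ler_normB _ _) _; have := fM y; have := gM y; lra.
  by rewrite ler_peMr// mulr_ge0.
have gdist : `|gauss_exp (fun u => f (u *m A)) - gauss_exp (fun u => g (u *m A))| <=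
    eps / 5 + 2 * M * gauss_exp (fun u => far l (u *m A)).
  have cfA := comp_continuous cf; have cgA := comp_continuous cg.
  have cmg : continuous (fun u : 'rV[R]_n => (-1) * g (u *m A)).
    exact: scale_continuous.
  have cfg : continuous (fun u : 'rV[R]_n => f (u *m A) + (-1) * g (u *m A)).
    by move=> u; exact: (cvgD (cfA u) (cmg u)).
  have cfar : continuous (fun u : 'rV[R]_n => 2 * M * far l (u *m A)).
    exact/scale_continuous/comp_continuous/far_continuous.
  have farM u : `|2 * M * far l (u *m A)| <= 2 * M * (2 * n%:R).
    rewrite ger0_norm ?mulr_ge0 ?far_ge0//.
    by rewrite ler_wpM2l ?mulr_ge0// far_le.
  have cbd : continuous (fun u : 'rV[R]_n => eps / 5 + 2 * M * far l (u *m A)).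
    by move=> u; exact: (cvgD (cvg_cst (eps / 5)) (cfar u)).
  have bdM u : `|eps / 5 + 2 * M * far l (u *m A)| <= eps / 5 + 2 * M * (2 * n%:R).
    apply: le_trans (ler_normD _ _) _; apply: lerD => //.
    by rewrite ger0_norm// ltW.
  have fgM u : `|f (u *m A) + (-1) * g (u *m A)| <= M + M.
    by apply: le_trans (ler_normD _ _) _; rewrite mulN1r normrN; apply: lerD.
  have mgM u : `|(-1) * g (u *m A)| <= M by rewrite mulN1r normrN.
  have -> : gauss_exp (fun u => f (u *m A)) - gauss_exp (fun u => g (u *m A)) =
      gauss_exp (fun u => f (u *m A) + (-1) * g (u *m A)).
    rewrite (gauss_expD (comp_continuous cf) cmg (fun u => fM _) mgM).
    by rewrite (gauss_expZ _ (comp_continuous cg) (fun u => gM _)) mulN1r.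
  have -> : eps / 5 + 2 * M * gauss_exp (fun u => far l (u *m A)) =
      gauss_exp (fun u => eps / 5 + 2 * M * far l (u *m A)).
    rewrite (gauss_expD (g := fun=> eps / 5) _ cfar (fun=> lexx _) farM); last first.
      exact: cst_continuous.
    rewrite gauss_exp_cst (gauss_expZ (M := 2 * n%:R))//.
      exact/comp_continuous/far_continuous.
    by move=> u; rewrite ger0_norm ?far_ge0// far_le.
  have pt u : `|f (u *m A) + (-1) * g (u *m A)| <= eps / 5 + 2 * M * far l (u *m A).
    by rewrite mulN1r; exact: fgfar.
  rewrite ler_norml; apply/andP; split.
    rewrite -[leLHS]mulN1r -(gauss_expZ _ cbd bdM).
    apply: (ler_gauss_exp (M1 := eps / 5 + 2 * M * (2 * n%:R)) _ cfg _ fgM).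
    - exact: scale_continuous.
    - by move=> u; rewrite mulN1r normrN.
    - move=> u; rewrite [leLHS]mulN1r.
      by have := pt u; rewrite ler_norml => /andP[].
  apply: (ler_gauss_exp cfg cbd fgM bdM) => u.
  by have := pt u; rewrite ler_norml => /andP[].
have /cvgrPdist_lt/(_ _ e5) tcv := trigpoly_cvg tg.
near=> t.
have t0 : (0 < t)%N by near: t; exact: nbhs_infty_gt.
have h1 : `|gauss_exp (fun u => g (u *m A)) - E e t (fun y => g (scaled t y))| < eps / 5.
  by near: t.
have h2 : `|E e t (fun y => f (scaled t y)) - E e t (fun y => g (scaled t y))| <=
    eps / 5 + eps / 5.
  have -> : E e t (fun y => f (scaled t y)) - E e t (fun y => g (scaled t y)) =
      E e t (fun y => f (scaled t y) + (-1) * g (scaled t y)).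
    by rewrite qexpD qexpZ mulN1r.
  apply: le_trans (qexp_norm x0 stepU step_ge0 e t _) _.
  apply: le_trans (_ : E e t (fun y => eps / 5 + 2 * M * far l (scaled t y)) <= _).
    by apply: ler_qexp => // y; rewrite mulN1r; exact: fgfar.
  rewrite qexpD qexp_cst// qexpZ lerD2l.
  apply: le_trans (ltW hL2); rewrite ler_wpM2l ?mulr_ge0//.
  exact: qexp_far.
set a := gauss_exp _ in gdist *; set a' := gauss_exp _ in gdist h1.
set q := E _ _ _ in h2 *; set q' := E _ _ _ in h2 h1.
have -> : a - q = (a - a') + (a' - q') - (q - q') by ring.
apply: le_trans (ler_normB _ _) _.
have := ler_normD (a - a') (a' - q'); lra.
Unshelve. all: by end_near. Qed.

End quenched_limit.

(** * From the stated hypotheses to a finite set of steps *)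

Lemma int_box_seq (n K : nat) : exists2 U : seq 'rV[int]_n, uniq U &
  forall u : 'rV[int]_n, u \notin U -> exists i, (K%:Z < `|u ord0 i|)%R.
Proof.
pose pt (v : {ffun 'I_n -> 'I_(K + K).+1}) : 'rV[int]_n :=
  \row_i ((v i : nat)%:Z - K%:Z).
exists (undup [seq pt v | v <- enum {ffun 'I_n -> 'I_(K + K).+1}]).
  exact: undup_uniq.
move=> u; rewrite mem_undup => uU; apply: contrapT => noi; move/negP: uU; apply.
have uK i : `|u ord0 i| <= K%:Z.
  by rewrite leNgt; apply/negP => h; apply: noi; exists i.
apply/mapP; exists [ffun i => inord `|(u ord0 i + K%:Z)%R|%N].
  by rewrite mem_enum.
apply/rowP => i; have := uK i; rewrite ler_norml => /andP[h1 h2].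
have h0 : 0 <= u ord0 i + K%:Z by rewrite -lerBlDr sub0r.
rewrite mxE ffunE inordK; first by rewrite gez0_abs// addrK.
rewrite ltnS -lez_nat gez0_abs// PoszD.
by rewrite lerD2r.
Qed.

(** Both sides are the quadratic form th eta^2 th^T; the left one is the variance of th.(U A) for a
    standard Gaussian U. *)
Lemma sqr_norm_mulmx_cov (R : realType) (n : nat) (A : 'M[R]_n)
  (P0 : 'rV[int]_n -> R) (U : seq 'rV[int]_n) (b : 'rV[R]_n) :
  A^T = A ->
  A *m A = (\matrix_(i, j) \sum_(u <- U)
    (zr R u 0 i - b 0 i) * (zr R u 0 j - b 0 j) * P0 u) ->
  forall th, \sum_i (th *m A^T) 0 i ^+ 2 = var0 P0 U b th.
Proof.
move=> AT AA th.
have -> : \sum_i (th *m A^T) 0 i ^+ 2 = (th *m (A *m A) *m th^T) 0 0.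
  transitivity (((th *m A^T) *m (th *m A^T)^T) 0 0).
    by rewrite mxE; apply: eq_bigr => i _; rewrite expr2; congr (_ * _); rewrite [RHS]mxE.
  by rewrite trmx_mul trmxK AT !mulmxA.
rewrite AA mxE /var0.
under eq_bigr => j _.
  rewrite mxE mulr_suml.
  under eq_bigr => i _ do rewrite mxE mulr_sumr mulr_suml.
  rewrite exchange_big /=.
  over.
rewrite exchange_big /=; apply: eq_bigr => u _.
rewrite /incr /dotv expr2 mulr_suml mulr_sumr; apply: eq_bigr => j _.
rewrite mulr_sumr mulr_sumr; apply: eq_bigr => i _.
by rewrite !mxE; ring.
Qed.

Theorem theorem2p1 (R : realType) (n : nat) (S : finType) (pi : S -> R)
  (P0 : 'rV[int]_n -> R) (c : 'rV[int]_n -> S -> R) (bc : 'rV[R]_n)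
  (x0 : 'rV[int]_n)
  (d : measure_display) (Omega : measurableType d) (P : probability Omega R)
  (xi : Omega -> 'rV[int]_n -> nat -> S)
  (A : 'M[R]_n) :
  (* pi is a probability measure on S *)
  (forall s, 0 <= pi s) -> \sum_(s : S) pi s = 1 ->
  (* P0 is a probability distribution on Z^n *)
  (forall u, 0 <= P0 u) -> \sum_(u \in [set: 'rV[int]_n]) P0 u = 1 ->
  (* bounded range of P0 and c *)
  (exists K : nat, forall u : 'rV[int]_n,
      (exists i, K%:Z < `|u ord0 i|) -> P0 u = 0 /\ forall s, c u s = 0) ->
  (forall u s, 0 <= P0 u + c u s <= 1) ->
  (forall s, \sum_(u \in [set: 'rV[int]_n]) c u s = 0) ->
  (forall u, \sum_(s : S) c u s * pi s = 0) ->
  (forall s, \sum_(u \in [set: 'rV[int]_n]) c u s *: zr R u = bc) ->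
  (* the environment is an i.i.d. field with one-site law pi *)
  iid_field P pi xi ->
  let Pbar := fun u => P0 u + \sum_(s : S) pi s * c u s in
  let b0 := \sum_(u \in [set: 'rV[int]_n]) P0 u *: zr R u in
  let b := b0 + bc in
  let eta2 : 'M[R]_n := \matrix_(i, j) \sum_(u \in [set: 'rV[int]_n])
        (zr R u 0 i - b 0 i) * (zr R u 0 j - b 0 j) * Pbar u in
  (* A = (eta^2)^{1/2}: the symmetric positive semidefinite square root *)
  A^T = A -> (forall v : 'rV[R]_n, 0 <= (v *m A *m v^T) 0 0) -> A *m A = eta2 ->
  {ae P, forall w,
     conv_law_gauss (fun t => qlaw P0 c (xi w) x0 t)
       (fun t y => (Num.sqrt (t%:R : R))^-1 *: (zr R y - t%:R *: b)) A}.
Proof.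
move=> pi_ge0 pi_sum1 P0_ge0 P0_sum1 [K rangeK] step01 c_sum0 env_mean c_drift iid.
move=> Pbar b0 b eta2 AT _ AA.
have [U uniqU boxU] := int_box_seq n K.
have P0U u : u \notin U -> P0 u = 0 by move=> /boxU/rangeK[].
have cU u s : u \notin U -> c u s = 0 by move=> /boxU/rangeK[_]; exact.
have stepU u s : u \notin U -> P0 u + c u s = 0.
  by move=> uU; rewrite P0U// cU// addr0.
have P0s : \sum_(u <- U) P0 u = 1 by rewrite -(fsum_seq uniqU P0U).
have step_sum1 s : \sum_(u <- U) (P0 u + c u s) = 1.
  by rewrite big_split /= P0s -(fsum_seq uniqU (cU^~ s)) c_sum0 addr0.
have step_mean s : \sum_(u <- U) (P0 u + c u s) *: (zr R u - b) = 0.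
  under eq_bigr do rewrite scalerBr.
  rewrite sumrB -scaler_suml step_sum1 scale1r.
  under eq_bigr do rewrite scalerDl.
  rewrite big_split /= /b -(c_drift s) /b0.
  rewrite !(fsum_seq uniqU) ?subrr// => u uU.
    by rewrite cU// scale0r.
  by rewrite P0U// scale0r.
(* [c] averages to 0 over the environment, so [eta2], defined with [Pbar], is the covariance behind
   [var0]. *)
have PbarE u : Pbar u = P0 u.
  rewrite /Pbar; under eq_bigr do rewrite mulrC.
  by rewrite env_mean addr0.
have cov : forall th, \sum_i (th *m A^T) 0 i ^+ 2 = var0 P0 U b th.
  apply: sqr_norm_mulmx_cov => //; rewrite AA; apply/matrixP => i j; rewrite !mxE.
  rewrite (fsum_seq uniqU); first by apply: eq_bigr => u _; rewrite PbarE.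
  by move=> u uU; rewrite PbarE P0U// mulr0.
have var_ge0 th : 0 <= var0 P0 U b th.
  by rewrite -cov sumr_ge0// => i _; exact: sqr_ge0.
(* The triples (L, k, q) are coded by naturals so that a single null set serves for all of them; a
   number that codes no triple imposes nothing. *)
have ae0 : {ae P, forall w, forall m : nat,
    if unpickle m is Some (L, k, q) then
      fluct P0 c x0 U b (L.+1%:R^-1 *: zr R k) (Num.sqrt (t%:R : R))^-1
        (if q then - (trigo.pi / 2) else 0) (xi w) t @[t --> \oo] --> (0 : R)
    else True}.
  apply: ae_foralln => m; case: (unpickle m) => [[[L k] q]|]; last exact: aeW.
  exact: ae_fluct_cvg0.
apply: filterS ae0 => w hw.
apply: (quenched_conv_law_gauss uniqU stepU step01 step_sum1 step_mean cov).
by move=> L k q; have := hw (pickle (L, k, q)); rewrite pickleK.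
Qed.
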